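(* Assume that there is a constant $M$ with $\big\|\log \frac{f_e}{g_e}\big\|_\infty \le M$ for all $e\in\widetilde E$, and that the change points $\lambda_1,\dots,\lambda_d$ are independent with geometric priors $\mathbb{P}(\lambda_j=k)=(1-\rho_j)^{k-1}\rho_j$, $k\in\mathbb{N}$, $\rho_j\in(0,1)$. Let $\mathcal{S}\subset[d]$ be nonempty and $\phi=\lambda_{\mathcal S}:=\min_{j\in\mathcal S}\lambda_j$. For $\alpha\in(0,1)$ let $$\tau_{\mathcal S}=\inf\{n\in\mathbb{N}:\ \mathbb{P}(\lambda_{\mathcal S}\le n\mid \mathbf{X}_*^n)\ge 1-\alpha\}.$$ Then $\tau_{\mathcal S}$ is asymptotically optimal for $\phi=\lambda_{\mathcal S}$; more specifically, as $\alpha\to0$, $$\mathbb{E}\big[\tau_{\mathcal S}-\lambda_{\mathcal S}\mid \tau_{\mathcal S}\ge\lambda_{\mathcal S}\big]=\frac{|\log\alpha|}{q_{\phi}+I_{\phi}}\,(1+o(1))$$ and $$\inf_{\widetilde\tau\in\Delta_\phi(\alpha)}\mathbb{E}\big[\widetilde\tau-\lambda_{\mathcal S}\mid\widetilde\tau\ge\lambda_{\mathcal S}\big]=\frac{|\log\alpha|}{q_{\phi}+I_{\phi}}\,(1+o(1)).$$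
   Context: Notation: $\mathbb{N}=\{1,2,\dots\}$, $[d]=\{1,\dots,d\}$, $a\wedge b=\min\{a,b\}$, $\|h\|_\infty=\sup_x|h(x)|$. Model. $G=(V,E)$ is an undirected graph with $V=[d]$; each $e\in E$ is a set $\{i,j\}$ with $i\ne j$. The extended edge set is $\widetilde E:=E\cup\{\{j\}:j\in V\}$. For each $e\in\widetilde E$ there are two probability densities $g_e$ (pre-change) and $f_e$ (post-change) with respect to a common underlying measure $\mu$. The random variables $\lambda_j\in\mathbb{N}$, $j\in[d]$, are the change points, and $\lambda_*=(\lambda_1,\dots,\lambda_d)$. For $e\in\widetilde E$ put $\lambda_e=\lambda_j$ if $e=\{j\}$ and $\lambda_e=\lambda_i\wedge\lambda_j$ if $e=\{i,j\}$. For each $e\in\widetilde E$ there is an observation sequence $\mathbf{X}_e=(X_e^1,X_e^2,\dots)$. Conditionally on $\lambda_*$, all the variables $X_e^t$ ($e\in\widetilde E$, $t\in\mathbb{N}$) are independent, with $X_e^t$ having density $g_e$ if $t<\lambda_e$ and density $f_e$ if $t\ge\lambda_e$. $\mathbf{X}_*^n=(X_e^t:\ e\in\widetilde E,\ 1\le t\le n)$ is the collection of all observations up to time $n$, and $\mathcal{F}_n=\sigma(\mathbf{X}_*^n)$. A sequential detection rule is a stopping time $\tau$ with respect to $(\mathcal{F}_n)_{n\ge0}$. For $\phi=\lambda_{\mathcal S}$, $\Delta_\phi(\alpha)$ is the set of all such stopping times $\tau$ with false alarm probability $\mathbb{P}(\tau<\phi)\le\alpha$. Information quantities: $I_e=\int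 f_e\log\frac{f_e}{g_e}\,d\mu$ for $e\in\widetilde E$; $I_\phi=\sum_{e\in\widetilde E,\ e\subset\mathcal S}I_e$; and $q_\phi=-\sum_{j\in\mathcal S}\log(1-\rho_j)$ (so that $\phi$ is geometric with parameter $1-e^{-q_\phi}$). *)

(* Defs.v *)
From HB Require Import structures.
From mathcomp Require Import all_boot all_order all_algebra.
From mathcomp Require Import all_classical all_reals all_analysis.

Set Implicit Arguments.
Unset Strict Implicit.
Unset Printing Implicit Defensive.

Import Order.TTheory GRing.Theory Num.Theory.
Import numFieldTopology.Exports numFieldNormedType.Exports.

Local Open Scope classical_set_scope.
Local Open Scope ring_scope.

Section Graph.
Variable d : nat.

Definition is_graph (E : {set {set 'I_d}}) : Prop :=
  forall e, e \in E -> #|e| = 2%N.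

Definition extended_edges (E : {set {set 'I_d}}) : {set {set 'I_d}} :=
  (E :|: [set [set j] | j : 'I_d])%SET.

(* The minimum of k over A. The maximum of k is only the starting value of the
   fold, so that the result is the minimum over A for every nonempty A. *)
Definition min_over (k : 'I_d -> nat) (A : {set 'I_d}) : nat :=
  \big[minn/(\max_j k j)%N]_(j in A) k j.

Lemma min_over_le k (A : {set 'I_d}) j : j \in A -> (min_over k A <= k j)%N.
Proof.
move=> jA; rewrite /min_over; move: (\max_i k i)%N (mem_index_enum j) => m.
elim: (index_enum _) => // i r IH; rewrite inE big_cons => /predU1P[<-|/IH].
  by rewrite jA geq_minl.
by case: ifP => // _ kj; apply: leq_trans kj; exact: geq_minr.
Qed.

Lemma min_over_attained k (A : {set 'I_d}) :
  A != finset.set0 -> exists2 j, j \in A & min_over k A = k j.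
Proof.
move=> /set0Pn[j0 j0A].
suff [h|//] : min_over k A = (\max_j k j)%N \/
              exists2 j, j \in A & min_over k A = k j.
  exists j0 => //; apply/eqP; rewrite eqn_leq min_over_le//= h.
  exact: (leq_bigmax j0).
rewrite /min_over; elim/big_rec : _ => [|j m jA [->|[i iA ->]]]; first by left.
- by right; exists j => //; apply/minn_idPl; exact: (leq_bigmax j).
- by right; have [_|_] := leqP (k j) (k i); [exists j|exists i].
Qed.

Lemma min_over1 k j : min_over k [set j]%SET = k j.
Proof.
have [|i] := @min_over_attained k [set j]%SET; last by rewrite inE => /eqP->.
by apply/set0Pn; exists j; rewrite inE.
Qed.

Lemma min_over2 k i j : min_over k [set i; j]%SET = minn (k i) (k j).
Proof.
apply/eqP; rewrite eqn_leq leq_min !min_over_le ?set21 ?set22//=.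
have [|l] := @min_over_attained k [set i; j]%SET.
  by apply/set0Pn; exists i; rewrite set21.
by rewrite !inE => /orP[] /eqP-> ->; rewrite ?geq_minl ?geq_minr.
Qed.

End Graph.

Section Densities.
Context {R : realType} {dT : measure_display} {T : measurableType dT}.
Variable mu : {measure set T -> \bar R}.
Local Open Scope ereal_scope.

Definition is_density (h : T -> R) : Prop :=
  [/\ measurable_fun setT h, (forall x, (0 <= h x)%R)
    & \int[mu]_x (h x)%:E = 1].

(* log (f / g), infinite where exactly one of the two densities vanishes,
   with the usual convention log (0 / 0) = 0. *)
Definition llr (f g : T -> R) (x : T) : \bar R :=
  if (f x == 0%R) && (g x == 0%R) then 0 else lne ((f x)%:E / (g x)%:E).

Definition sup_norm (h : T -> \bar R) : \bar R :=
  ereal_sup (range (fun x => `|h x|)).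

Definition kl_info (f g : T -> R) : R :=
  fine (\int[mu]_x ((f x)%:E * llr f g x)).

End Densities.

Section Probability.
Context {R : realType} {dO : measure_display} {Omega : measurableType dO}.
Variable P : probability Omega R.
Local Open Scope ereal_scope.

Definition cond_pr (B A : set Omega) : \bar R := P (A `&` B) / P B.

Definition cond_expect (Y : Omega -> \bar R) (B : set Omega) : \bar R :=
  (\int[P]_(w in B) Y w) / P B.

(* Q is a parameter so that it can be P or a conditional probability. *)
Definition mutually_independent {dT : measure_display}
    {T : measurableType dT} {I : eqType} (Q : set Omega -> \bar R)
    (J : set I) (Y : I -> Omega -> T) : Prop :=
  forall (s : seq I) (A : I -> set T),
    uniq s -> [set` s] `<=` J -> (forall i, i \in s -> measurable (A i)) ->
    Q (\bigcap_(i in [set` s]) (Y i @^-1` A i)) =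
    \big[*%E/1]_(i <- s) Q (Y i @^-1` A i).

(* Z is a version of the conditional probability of A given the sub-sigma-
   algebra F; versions are unique only up to P-null sets. *)
Definition is_cond_pr (F : set (set Omega)) (A : set Omega)
    (Z : Omega -> R) : Prop :=
  [/\ (forall B : set R, measurable B -> F (Z @^-1` B)),
      P.-integrable setT (EFin \o Z)
    & forall B, F B -> \int[P]_(w in B) (Z w)%:E = P (A `&` B)].

Definition is_stopping_time (F : nat -> set (set Omega))
    (tau : Omega -> \bar R) : Prop :=
  (forall w, tau w = +oo \/ exists n : nat, tau w = n%:R%:E) /\
  (forall n : nat, F n [set w | tau w <= n%:R%:E]).

Definition detection_rules (F : nat -> set (set Omega)) (phi : Omega -> nat)
    (a : R) : set (Omega -> \bar R) :=
  [set tau | is_stopping_time F tau /\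
             P [set w | tau w < (phi w)%:R%:E] <= a%:E].

Definition detection_delay (phi : Omega -> nat) (tau : Omega -> \bar R) :
    \bar R :=
  cond_expect (fun w => tau w - (phi w)%:R%:E)
              [set w | (phi w)%:R%:E <= tau w].

Definition optimal_delay (F : nat -> set (set Omega)) (phi : Omega -> nat)
    (a : R) : \bar R :=
  ereal_inf [set detection_delay phi tau | tau in detection_rules F phi a].

End Probability.

Section Asymptotics.
Context {R : realType}.

(* u a = v a (1 + o(1)) as a decreases to 0 *)
Definition asymp_eq0 (u v : R -> \bar R) : Prop :=
  exists2 eps : R -> R, eps a @[a --> 0^'+] --> (0 : R)
    & \forall a \near 0^'+, u a = (v a * (1 + eps a)%:E)%E.

Definition asymptotically_optimal {dO : measure_display}
    {Omega : measurableType dO} (P : probability Omega R)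
    (F : nat -> set (set Omega)) (phi : Omega -> nat)
    (tau : R -> Omega -> \bar R) : Prop :=
  (forall a, 0 < a < 1 -> detection_rules P F phi a (tau a)) /\
  asymp_eq0 (fun a => detection_delay P phi (tau a))
            (optimal_delay P F phi).

End Asymptotics.

Section Model.
Context {R : realType} {d : nat} {dT : measure_display}
  {T : measurableType dT} {dO : measure_display} {Omega : measurableType dO}.
Variables (E : {set {set 'I_d}}) (mu : {measure set T -> \bar R})
  (g f : {set 'I_d} -> T -> R) (P : probability Omega R)
  (lam : 'I_d -> Omega -> nat) (X : {set 'I_d} -> nat -> Omega -> T).

Definition lam_min (A : {set 'I_d}) (w : Omega) : nat :=
  min_over (fun j => lam j w) A.

(* Only e in the extended edge set and t >= 1 are observed; the other values
   of X are irrelevant. *)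
Definition obs_index : set ({set 'I_d} * nat) :=
  [set i | i.1 \in extended_edges E /\ (1 <= i.2)%N].

(* lambda_* takes countably many values, so conditioning on it means
   conditioning on the events of positive probability below. *)
Definition change_event (k : 'I_d -> nat) : set Omega :=
  [set w | forall j, lam j w = k j].

Definition obs_density (k : 'I_d -> nat) (e : {set 'I_d}) (t : nat) : T -> R :=
  if (t < min_over k e)%N then g e else f e.

Definition observation_model : Prop :=
  forall k : 'I_d -> nat, (0 < P (change_event k))%E ->
    mutually_independent (cond_pr P (change_event k)) obs_index
      (fun i => X i.1 i.2) /\
    (forall e t (A : set T), obs_index (e, t) -> measurable A ->
      cond_pr P (change_event k) (X e t @^-1` A) =
      (\int[mu]_(x in A) (obs_density k e t x)%:E)%E).

Definition obs_filtration (n : nat) : set (set Omega) :=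
  <<s \bigcup_(i in [set i | obs_index i /\ (i.2 <= n)%N])
        preimage_set_system setT (X i.1 i.2) measurable >>.

Definition geometric_prior (rho : 'I_d -> R) : Prop :=
  forall j (k : nat), (1 <= k)%N ->
    P [set w | lam j w = k] = ((1 - rho j) ^+ k.-1 * rho j)%:E.

(* post n is meant to be the posterior probability of a change by time n. *)
Definition tau_threshold (post : nat -> Omega -> R) (a : R) (w : Omega) :
    \bar R :=
  ereal_inf [set (n%:R%:E : \bar R) |
              n in [set n : nat | (1 <= n)%N /\ 1 - a <= post n w]].

Definition q_info (rho : 'I_d -> R) (S : {set 'I_d}) : R :=
  - \sum_(j in S) ln (1 - rho j).

Definition I_info (S : {set 'I_d}) : R :=
  \sum_(e in extended_edges E | e \subset S) kl_info mu (f e) (g e).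

End Model.

(* Main.v *)
Require Import Defs.
From HB Require Import structures.
From mathcomp Require Import all_boot all_order all_algebra.
From mathcomp Require Import all_classical all_reals all_analysis.
From mathcomp Require Import measurable_realfun simple_functions.
From mathcomp Require Import ring lra zify.

Set Implicit Arguments.
Unset Strict Implicit.
Unset Printing Implicit Defensive.

Import Order.TTheory GRing.Theory Num.Theory.
Import numFieldTopology.Exports numFieldNormedType.Exports.

Local Open Scope classical_set_scope.
Local Open Scope ring_scope.

(** The likelihood of the data given a configuration [k] of all change points
    is explicit, so the laws given two configurations are related on [F_n] by
    the ratio [exp (log_lik k k' n)].  Edges inside [S] contribute drift
    [I_phi] per time step once all their vertices have changed; an edge leaving
    [S] is changed on its own once its outer vertex has changed, so it
    contributes only boundedly many terms.

    Lower bound: delay the change points in [S] by [m + 1].  This multiplies the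
    prior by [exp (- q_phi (m + 1))] and, up to time [phi + m], the likelihood
    by about [exp (- I_phi m)], while [tau <= phi + m] becomes a false alarm.
    Hence [P (phi <= tau <= phi + m)] is at most about
    [alpha exp ((q_phi + I_phi) m)] for every admissible rule.

    Upper bound: when the posterior at time [n] is below [1 - alpha], the odds of
    [phi > n] are at least [alpha].  These odds are bounded, for each value of
    the change points outside [S], by [exp (- q_phi m)] times a likelihood ratio
    of size about [exp (- I_phi m)], where [m = n - phi].  So the threshold rule
    can exceed [phi + m] with [m > |log alpha| / (q_phi + I_phi)] only on an
    atypical event, whose probability is exponentially small in [m] by Chernoff
    bounds.  Both estimates hold outside the event that the largest change point
    exceeds a small fraction of [m], which is exponentially unlikely as well. *)

(** * Expectations of products of independent variables *)

(** The posterior enters only as some version [post n] of a conditional probability, known through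
    its integrals over events of F_n, and the change points outside [S] stay hidden from the rule.
    Posterior arguments therefore have to run on events of F_n. This shapes the typical event
    [good_lik] of the upper bound: it constrains the likelihood ratio for all configurations outside
    [S] at once instead of the true one. By time n only finitely many of these can be told apart, so
    the union bound costs a polynomial factor, which the exponential decay absorbs.

    Comparisons of two configurations are made one configuration at a time and then summed over the
    countably many, so the factors gained must not depend on the configuration. The infimum over
    rules adds a second uniformity: the constants in the decay estimates depend neither on the rule
    nor on alpha. *)

Section WeightedIntegral.
Context {R : realType} {d d' : measure_display} {T : measurableType d}
  {Z : measurableType d'} (m : {measure set Z -> \bar R}) (C : set Z)
  (W : Z -> R) (Y : Z -> T).
Hypotheses (mC : measurable C) (mW : measurable_fun setT W)
  (W0 : forall x, 0 <= W x) (mY : measurable_fun setT Y).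
Local Open Scope ereal_scope.
Import HBNNSimple.

Lemma weighted_integral_nnsfun (h : {nnsfun T >-> R}) :
  \int[m]_(x in C) (W x * h (Y x))%:E =
  \sum_(y \in range h) y%:E * \int[m]_(x in C) (W x * \1_(h @^-1` [set y]) (Y x))%:E.
Proof.
have mY1 y : measurable_fun C (fun x => (W x * \1_(h @^-1` [set y]) (Y x))%:E).
  apply/measurable_EFinP; apply: measurable_funTS; apply: measurable_funM => //.
  by apply: measurableT_comp.
transitivity (\int[m]_(x in C) \sum_(y \in range h)
    (y%:E * (W x * \1_(h @^-1` [set y]) (Y x))%:E)).
  apply: eq_integral => x _; rewrite fsumEFin//; congr (_%:E).
  rewrite [in LHS](fimfunE h) mulr_fsumr; apply: eq_fsbigr => y _.
  by rewrite mulrCA.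
rewrite ge0_integral_fsum//.
- apply: eq_fsbigr => y; rewrite inE => -[t _ <-].
  rewrite ge0_integralZl// ?lee_fin//.
  by move=> x _; rewrite lee_fin mulr_ge0.
- by move=> y; apply: measurable_funeM.
- move=> y x _; have [[t _ <-]|hy] := pselect (range h y).
    by rewrite -EFinM lee_fin !mulr_ge0.
  rewrite preimage10 ?indic0 ?mulr0 ?mule0//.
Qed.

Lemma weighted_integral_lim (h : T -> R) (mh : measurable_fun setT (EFin \o h)) :
  (forall x, (0 <= h x)%R) ->
  \int[m]_(x in C) (W x * h (Y x))%:E =
  limn (fun n => \int[m]_(x in C) (W x * nnsfun_approx measurableT mh n (Y x))%:E).
Proof.
move=> h0; rewrite -monotone_convergence//.
- apply: eq_integral => x _; apply/esym/cvg_lim => //.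
  have h'0 y : setT y -> (0 <= (EFin \o h) y) by rewrite lee_fin.
  have /(@cvgeZl _ _ _ _ _ (W x)%:E isT) := cvg_nnsfun_approx measurableT mh h'0 (Logic.I : setT (Y x)).
  by rewrite -EFinM.
- move=> n; apply/measurable_EFinP; apply: measurable_funTS.
  apply: measurable_funM => //.
  by apply: measurableT_comp.
- by move=> n x _; rewrite lee_fin mulr_ge0.
- move=> x _ a b ab; rewrite lee_fin ler_wpM2l//.
  exact/lefP/nd_nnsfun_approx.
Qed.

End WeightedIntegral.

Section WeightedIntegralExt.
Import HBNNSimple.

(* Nonnegative functions are limits of simple ones, so that both sides are
   determined by their values on indicators. *)
Lemma weighted_integral_ext {R : realType} {d d1 d2 : measure_display}
    {T : measurableType d} {Z1 : measurableType d1} {Z2 : measurableType d2}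
    (m1 : {measure set Z1 -> \bar R}) (m2 : {measure set Z2 -> \bar R})
    (C1 : set Z1) (C2 : set Z2) (W1 : Z1 -> R) (W2 : Z2 -> R)
    (Y1 : Z1 -> T) (Y2 : Z2 -> T) (h : T -> R) :
  measurable C1 -> measurable_fun setT W1 -> (forall x, 0 <= W1 x) ->
  measurable_fun setT Y1 ->
  measurable C2 -> measurable_fun setT W2 -> (forall x, 0 <= W2 x) ->
  measurable_fun setT Y2 ->
  (forall A, measurable A ->
    \int[m1]_(x in C1) (W1 x * \1_A (Y1 x))%:E =
    \int[m2]_(x in C2) (W2 x * \1_A (Y2 x))%:E)%E ->
  measurable_fun setT h -> (forall x, 0 <= h x) ->
  (\int[m1]_(x in C1) (W1 x * h (Y1 x))%:E =
   \int[m2]_(x in C2) (W2 x * h (Y2 x))%:E)%E.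
Proof.
move=> mC1 mW1 W10 mY1 mC2 mW2 W20 mY2 H mh h0.
have mh' : measurable_fun setT (EFin \o h) by exact/measurable_EFinP.
rewrite (weighted_integral_lim m1 mC1 mW1 W10 mY1 mh' h0).
rewrite (weighted_integral_lim m2 mC2 mW2 W20 mY2 mh' h0).
congr (limn _); apply/funext => n.
rewrite !weighted_integral_nnsfun//.
by apply: eq_fsbigr => y _; rewrite H.
Qed.

End WeightedIntegralExt.

Lemma density_fin_num {R : realType} {dT : measure_display} {T : measurableType dT}
    (mu : {measure set T -> \bar R}) (D : T -> R) (A : set T) :
  is_density mu D -> measurable A ->
  (\int[mu]_(x in A) (D x)%:E \is a fin_num)%E.
Proof.
move=> [mD D0 D1] mA.
rewrite ge0_fin_numE; last by apply: integral_ge0 => x _; rewrite lee_fin.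
apply: (@le_lt_trans _ _ 1%E); last exact: ltry.
rewrite -D1; apply: ge0_subset_integral => //; first exact/measurable_EFinP.
by move=> x _; rewrite lee_fin.
Qed.

Section ProductFormula.
Context {R : realType} {dT dO : measure_display} {T : measurableType dT}
  {Omega : measurableType dO} (mu : {measure set T -> \bar R})
  (P : probability Omega R) {I : eqType} (C : set Omega)
  (Y : I -> Omega -> T) (D : I -> T -> R) (s : seq I) (c : R).
Hypotheses (mC : measurable C) (mY : forall i, measurable_fun setT (Y i))
  (densD : forall i, i \in s -> is_density mu (D i)) (us : uniq s)
  (c0 : 0 <= c).
Hypothesis rect : forall A : I -> set T, (forall i, measurable (A i)) ->
  P (C `&` \bigcap_(i in [set` s]) (Y i @^-1` A i)) =
  (c%:E * \big[*%E/1]_(i <- s) \int[mu]_(x in A i) (D i x)%:E)%E.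

Lemma indic_density_fin i (A : set T) : i \in s -> measurable A ->
  (\int[mu]_x (\1_A x * D i x)%:E =
   (fine (\int[mu]_(x in A) (D i x)%:E))%:E)%E.
Proof.
move=> si mA; rewrite fineK; last by apply: density_fin_num => //; exact: densD.
rewrite [RHS]integral_mkcond; apply: eq_integral => x _.
by rewrite epatch_indic EFinM muleC.
Qed.

Lemma prod_indic_preimage (A : I -> set T) w :
  \prod_(i <- s) \1_(A i) (Y i w) =
  \1_(\bigcap_(i in [set` s]) (Y i @^-1` A i)) w :> R.
Proof.
rewrite [RHS]indicE; have [h|h] := boolP (w \in _).
  rewrite big_seq big1// => i si; rewrite indicE mem_set//.
  by move/set_mem: h => /(_ i si).
have [i si hi] : exists2 i, i \in s & ~ A i (Y i w).
  apply: contrapT => H; move/negP: h; apply; apply/mem_set => i /= si.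
  by apply: contrapT => h; apply: H; exists i.
by rewrite (bigD1_seq i)//= indicE memNset// mul0r.
Qed.

(* Induction on the set [r] of factors that are not yet indicators. *)
Lemma ge0_expectation_prod_sub (r : seq I) (h : I -> T -> R) (v : I -> R) :
  {subset r <= s} ->
  (forall i, measurable_fun setT (h i)) -> (forall i x, 0 <= h i x) ->
  (forall i, i \in s -> (\int[mu]_x (h i x * D i x)%:E = (v i)%:E)%E) ->
  (forall i, i \notin r -> exists2 A, measurable A & h i = \1_A) ->
  (\int[P]_(w in C) (\prod_(i <- s) h i (Y i w))%:E =
   (c * \prod_(i <- s) v i)%:E)%E.
Proof.
elim: r h v => [|i r IH] h v rs mh h0 hv hA0.
  have [A mAhA] : {A : I -> set T & forall i, measurable (A i) /\ h i = \1_(A i)}.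
    apply: (@choice _ _ (fun i A => measurable A /\ h i = \1_A)) => i.
    by have [A ? ?] := hA0 i isT; exists A.
  have mA i := (mAhA i).1.
  under eq_integral => w _.
    rewrite (eq_bigr (fun i => \1_(A i) (Y i w))); last first.
      by move=> i _; rewrite (mAhA i).2.
    rewrite prod_indic_preimage; over.
  rewrite integral_indic//; last first.
    apply: fin_bigcap_measurable; first exact: finite_seq.
    by move=> i _; rewrite -[X in measurable X]setTI; exact: mY.
  transitivity (P (C `&` \bigcap_(i in [set` s]) (Y i @^-1` A i))).
    by rewrite setIC.
  rewrite rect// EFinM; congr (_ * _)%E.
  rewrite -prodEFin big_seq [in RHS]big_seq; apply: eq_bigr => i si.
  by rewrite -hv// (mAhA i).2 indic_density_fin// fineK//; apply: density_fin_num => //; exact: densD.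
have si : i \in s by apply: rs; rewrite mem_head.
have rs' : {subset r <= s} by move=> l lr; apply: rs; rewrite inE lr orbT.
have v0 l : l \in s -> 0 <= v l.
  move=> sl; rewrite -lee_fin -hv//; apply: integral_ge0 => x _.
  by rewrite lee_fin mulr_ge0//; have [_ ->] := densD sl.
have [mD D0 D1] := densD si.
pose V := \prod_(l <- s | l != i) v l.
have V0 : 0 <= V by rewrite /V big_seq_cond prodr_ge0// => l /andP[/v0].
transitivity (\int[P]_(w in C)
    ((\prod_(l <- s | l != i) h l (Y l w)) * h i (Y i w))%:E)%E.
  by apply: eq_integral => w _; rewrite (bigD1_seq i)//= mulrC.
(* Factor [i] sees the other factors only as a weight on [Omega]. By extensionality it is enough to
   test an indicator in place of [h i], and this is the induction hypothesis with one more
   indicator. *)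
rewrite (@weighted_integral_ext _ _ _ _ _ _ _ P mu C setT
  (fun w => \prod_(l <- s | l != i) h l (Y l w)) (fun x => c * V * D i x)
  (Y i) id)//.
- under eq_integral => x _ do rewrite -mulrA EFinM [D i x * _]mulrC.
  rewrite ge0_integralZl//.
  + by rewrite hv// (bigD1_seq i)//= -EFinM -mulrA [V * _]mulrC.
  + by apply/measurable_EFinP; apply: measurable_funM.
  + by move=> x _; rewrite lee_fin mulr_ge0.
  + by rewrite lee_fin mulr_ge0.
- under eq_fun do rewrite big_mkcond.
  apply: measurable_prod => l _; case: (l != i) => //.
  exact: measurableT_comp.
- by move=> w; apply: prodr_ge0.
- exact: measurable_funM.
- by move=> x; rewrite !mulr_ge0.
move=> A mA; pose u := fine (\int[mu]_(x in A) (D i x)%:E)%E.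
pose hA l := if l == i then \1_A else h l.
pose vA l := if l == i then u else v l.
have hAE w : \prod_(l <- s) hA l (Y l w) =
    (\prod_(l <- s | l != i) h l (Y l w)) * \1_A (Y i w).
  rewrite (bigD1_seq i)//= {1}/hA eqxx mulrC; congr (_ * _).
  by apply: eq_bigr => l /negbTE li; rewrite /hA li.
have vAE : \prod_(l <- s) vA l = V * u.
  rewrite (bigD1_seq i)//= {1}/vA eqxx mulrC; congr (_ * _).
  by apply: eq_bigr => l /negbTE li; rewrite /vA li.
under eq_integral => w _ do rewrite -hAE.
rewrite (IH hA vA)//.
- rewrite vAE; under eq_integral => x _ do rewrite -mulrA EFinM [D i x * _]mulrC.
  rewrite ge0_integralZl//.
  + by rewrite indic_density_fin// -EFinM mulrA.
  + apply/measurable_EFinP; apply: measurable_funM => //.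
  + by move=> x _; rewrite lee_fin mulr_ge0.
  + by rewrite lee_fin mulr_ge0.
- by move=> l; rewrite /hA; case: ifP.
- by move=> l x; rewrite /hA; case: ifP.
- move=> l sl; rewrite /hA /vA; case: ifP => [/eqP->|_]; last exact: hv.
  exact: indic_density_fin.
- move=> l lr; rewrite /hA; case: ifPn => [_|li]; first by exists A.
  by apply: hA0; rewrite inE negb_or li.
Qed.

Lemma ge0_expectation_prod (h : I -> T -> R) (v : I -> R) :
  (forall i, i \in s -> measurable_fun setT (h i)) -> (forall i x, 0 <= h i x) ->
  (forall i, i \in s -> (\int[mu]_x (h i x * D i x)%:E = (v i)%:E)%E) ->
  (\int[P]_(w in C) (\prod_(i <- s) h i (Y i w))%:E =
   (c * \prod_(i <- s) v i)%:E)%E.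
Proof.
move=> mh h0 hv.
(* Indices outside [s] are padded with an indicator, as the induction asks for regularity at every
   index. *)
pose g i := if i \in s then h i else \1_setT.
transitivity (\int[P]_(w in C) (\prod_(i <- s) g i (Y i w))%:E)%E.
  apply: eq_integral => w _; congr (_%:E).
  by rewrite big_seq [RHS]big_seq; apply: eq_bigr => i si; rewrite /g si.
apply: (@ge0_expectation_prod_sub s) => //.
- by move=> i; rewrite /g; case: ifPn => // /mh.
- by move=> i x; rewrite /g; case: ifP.
- by move=> i si; rewrite /g si hv.
- by move=> i /negbTE si; rewrite /g si; exists setT.
Qed.

End ProductFormula.

(** * Log-likelihood ratio of two densities *)

Lemma expR_sum {R : realType} (I : Type) (s : seq I) (Q : pred I) (F : I -> R) :
  expR (\sum_(i <- s | Q i) F i) = \prod_(i <- s | Q i) expR (F i).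
Proof. by rewrite (big_morph _ (@expRD R) (@expR0 R)). Qed.

(** [exp t <= 1 / (1 - t)], and the quadratic times [1 - t] equals [1 + t ^ 2 (1 - 2 t)], at least 1
    exactly when [t <= 1/2] or [t = 0]. Every later condition [th * M <= 2^-1] originates here. *)
Lemma expR_le_quad {R : realType} (t : R) :
  t <= 2^-1 -> expR t <= 1 + t + 2 * t ^+ 2.
Proof.
move=> t2; have t1 : 0 < 1 - t by rewrite subr_gt0 (le_lt_trans t2)// invf_lt1// ltr1n.
have h : expR t <= (1 - t)^-1.
  rewrite -[t in expR t]opprK expRN lef_pV2 ?posrE ?expR_gt0//.
  exact: expR_ge1Dx.
rewrite (le_trans h)// -[leLHS]mul1r ler_pdivrMr//.
have -> : (1 + t + 2 * t ^+ 2) * (1 - t) = 1 + t ^+ 2 * (1 - 2 * t) by ring.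
rewrite lerDl mulr_ge0 ?sqr_ge0// subr_ge0.
by rewrite mulrC -ler_pdivlMr// mul1r.
Qed.

Section LogLikelihood.
Context {R : realType} {dT : measure_display} {T : measurableType dT}
  (mu : {measure set T -> \bar R}).
Implicit Types (f g : T -> R).

(** Real-valued form of [llr]: where both densities vanish the difference is 0, as the convention
    asks, and a finite sup norm excludes points where exactly one vanishes. *)
Definition llrR f g x : R := ln (f x) - ln (g x).

Section Pair.
Variables (f g : T -> R) (M : R).
Hypotheses (df : is_density mu f) (dg : is_density mu g)
  (supM : (sup_norm (llr f g) <= M%:E)%E).

Lemma llrR_spec x :
  [/\ llr f g x = (llrR f g x)%:E, `|llrR f g x| <= M
    & f x = g x * expR (llrR f g x)].
Proof.
have [_ f0 _] := df; have [_ g0 _] := dg.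
have : (`|llr f g x| <= M%:E)%E.
  by apply: le_trans supM; apply: ereal_sup_ubound; exists x.
rewrite /llr /llrR; have [fx|fx] := eqVneq (f x) 0; have [gx|gx] := eqVneq (g x) 0.
- by rewrite fx gx /= subrr normr0 expR0 mul0r.
- by rewrite /= fx mul0e /= lexx.
- by rewrite gx/= inve0 gt0_muley// lte_fin lt0r fx f0.
have fx0 : 0 < f x by rewrite lt0r fx f0.
have gx0 : 0 < g x by rewrite lt0r gx g0.
rewrite /= inver (negbTE gx) -EFinM lne_EFin ?divr_gt0// ln_div ?posrE// => h.
split => //; rewrite expRD expRN !lnK ?posrE//.
by rewrite mulrCA divff ?mulr1.
Qed.

Lemma measurable_llrR : measurable_fun setT (llrR f g).
Proof.
have [mf _ _] := df; have [mg _ _] := dg.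
by apply: measurable_funB; apply: measurableT_comp.
Qed.

Let mf : measurable_fun setT f. Proof. by have [] := df. Qed.
Let f0 x : 0 <= f x. Proof. by have [_ + _] := df. Qed.
Let ml : measurable_fun setT (fun x => llrR f g x * f x).
Proof. by apply: measurable_funM => //; exact: measurable_llrR. Qed.

Lemma integrable_density : mu.-integrable setT (EFin \o f).
Proof.
have [_ _ f1] := df; apply/integrableP; split; first exact/measurable_EFinP.
under eq_integral do rewrite /= ger0_norm//.
by rewrite f1 ltry.
Qed.

Lemma integrable_llrR_density :
  mu.-integrable setT (EFin \o (fun x => llrR f g x * f x)).
Proof.
apply: (le_integrable _ _ _ (integrableZl measurableT M integrable_density)) => //.
  exact/measurable_EFinP.
move=> x _; have [_ lM _] := llrR_spec x.
rewrite -EFinM lee_fin !normrM ler_wpM2r// (le_trans lM)// ler_norm//.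
Qed.

Lemma kl_infoE : (\int[mu]_x (llrR f g x * f x)%:E = (kl_info mu f g)%:E)%E.
Proof.
rewrite /kl_info (_ : (fun x => (_ * llr f g x)%E) = (EFin \o (fun x => llrR f g x * f x))); last first.
  by apply/funext => x; have [-> _ _] := llrR_spec x; rewrite -EFinM mulrC.
by rewrite fineK// integrable_fin_num// integrable_llrR_density.
Qed.

Lemma integral_affine_llrR (a b : R) :
  (\int[mu]_x (a * f x + b * (llrR f g x * f x))%:E = (a + b * kl_info mu f g)%:E)%E.
Proof.
have [_ _ f1] := df.
under eq_integral do rewrite EFinD !EFinM -[X in (_ + _ * X)%E]EFinM.
rewrite integralD//; last 2 first.
- exact: (integrableZl measurableT a integrable_density).
- exact: (integrableZl measurableT b integrable_llrR_density).
rewrite (integralZl measurableT integrable_density).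
rewrite (integralZl measurableT integrable_llrR_density).
by rewrite f1 kl_infoE mule1 EFinD EFinM.
Qed.

(* Integrate [f (1 - log (f / g)) <= f exp (- log (f / g)) = g]. *)
Lemma kl_info_ge0 : 0 <= kl_info mu f g.
Proof.
have [mg g0 g1] := dg.
suff : ((1 - kl_info mu f g)%:E <= 1)%E by rewrite lee_fin gerBl.
rewrite -[X in (_ <= X)%E]g1 -mulN1r -integral_affine_llrR.
apply: le_integral => //.
- rewrite (_ : (fun x => _) = (EFin \o f) \+ (fun x => (-1)%:E * (llrR f g x * f x)%:E)%E).
    apply: integrableD => //; first exact: integrable_density.
    exact: (integrableZl measurableT (-1) integrable_llrR_density).
  by apply/funext => x; rewrite mul1r.
- apply/integrableP; split; first exact/measurable_EFinP.
  by under eq_integral do rewrite /= ger0_norm//; rewrite g1 ltry.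
move=> x _; rewrite lee_fin; have [_ _ fE] := llrR_spec x.
rewrite mul1r mulN1r -[X in X - _]mul1r -mulrBl fE mulrCA -[leRHS]mulr1.
rewrite ler_wpM2l//.
apply: (@le_trans _ _ (expR (- llrR f g x) * expR (llrR f g x))).
  by rewrite ler_wpM2r ?expR_ge0// (le_trans _ (expR_ge1Dx _)).
by rewrite -expRD addNr expR0.
Qed.

(** The quadratic bound is integrated against [f], and [1 + x <= exp x] restores an exponential. The
    sign of [th] is free: positive values control the upper tail of the likelihood ratio, negative
    ones the lower tail. *)
Lemma llrR_mgf (th : R) : `|th| * M <= 2^-1 ->
  (\int[mu]_x (expR (th * llrR f g x) * f x)%:E <=
   (expR (th * kl_info mu f g + 2 * th ^+ 2 * M ^+ 2))%:E)%E.
Proof.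
move=> thM; set I := kl_info mu f g; set k := 1 + 2 * th ^+ 2 * M ^+ 2.
have pt x : expR (th * llrR f g x) <= k + th * llrR f g x.
  have [_ lM _] := llrR_spec x.
  have tl : `|th * llrR f g x| <= `|th| * M by rewrite normrM ler_wpM2l.
  rewrite (le_trans (expR_le_quad _))//.
    by rewrite (le_trans (ler_norm _))// (le_trans tl).
  rewrite /k addrAC lerD2r lerD2l -mulrA ler_wpM2l// -exprMn.
  by rewrite -[leLHS]real_normK ?num_real// -[leRHS]real_normK ?num_real// lerXn2r ?nnegrE//
    normrM [leRHS]normrM ler_wpM2l// (le_trans lM) ?ler_norm.
apply: (@le_trans _ _ (\int[mu]_x (k * f x + th * (llrR f g x * f x))%:E)%E).
  apply: ge0_le_integral => //.
  - by move=> x _; rewrite lee_fin mulr_ge0 ?expR_ge0.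
  - apply/measurable_EFinP; apply: measurable_funM => //.
    apply: measurableT_comp => //; apply: measurable_funM => //.
    exact: measurable_llrR.
  - by apply/measurable_EFinP; apply: measurable_funD; apply: measurable_funM.
  - by move=> x _; rewrite lee_fin mulrA -mulrDl ler_wpM2r.
rewrite integral_affine_llrR lee_fin (le_trans _ (expR_ge1Dx _))//.
by rewrite /k addrAC addrA.
Qed.

End Pair.
End LogLikelihood.

(** * Geometric change points *)

Section ChangePoints.
Context {R : realType} {d : nat} {dO : measure_display}
  {Omega : measurableType dO} (P : probability Omega R)
  (lam : 'I_d -> {RV P >-> nat}) (rho : 'I_d -> R).
Hypotheses (lam1 : forall j w, (1 <= lam j w)%N)
  (lam_indep : mutually_independent P setT lam)
  (rho01 : forall j, 0 < rho j < 1)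
  (lam_geo : geometric_prior P lam rho).

Lemma measurable_lam_set j (A : set nat) : measurable [set w | A (lam j w)].
Proof. by rewrite -[X in measurable X]setTI; exact: measurable_funPT. Qed.

Lemma measurable_lam_rect (A : 'I_d -> set nat) :
  measurable [set w | forall j, A j (lam j w)].
Proof.
rewrite (_ : [set _ | _] = \bigcap_(j in setT) [set w | A j (lam j w)]).
  apply: fin_bigcap_measurable => // j _; exact: measurable_lam_set.
by apply/seteqP; split => [w h j _|w h j]; exact: h.
Qed.

Lemma measurable_lam_pred (A : set ('I_d -> nat)) :
  measurable [set w | A (fun j => lam j w)].
Proof.
rewrite (_ : [set _ | _] = \bigcup_(k : {ffun 'I_d -> nat})
    [set w | A k /\ forall j, [set k j] (lam j w)]).
  apply: countable_bigcupT_measurable => [|k]; first exact: countableP.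
  have [Ak|nAk] := pselect (A k).
    rewrite (_ : [set _ | _] = [set w | forall j, [set k j] (lam j w)]).
      exact: (measurable_lam_rect (fun j => [set k j])).
    by apply/seteqP; split => [w []//|w h].
  by rewrite (_ : [set _ | _] = set0)//; apply/seteqP; split => [w []|].
apply/seteqP; split => [w Aw|w [k _ [Ak kw]]] /=.
  exists [ffun j => lam j w] => //=; split => [|j]; last by rewrite ffunE.
  by rewrite (_ : fun_of_fin _ = fun j => lam j w)//; apply/funext => j; rewrite ffunE.
by rewrite (_ : (fun j => _) = k)//; apply/funext => j; rewrite kw.
Qed.

Lemma pr_lam_rect (A : 'I_d -> set nat) :
  (P [set w | forall j, A j (lam j w)] =
  \prod_j P [set w | A j (lam j w)])%E.
Proof.
have := @lam_indep (enum 'I_d) A (enum_uniq _) (fun _ _ => I).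
rewrite big_enum/= => <- //.
congr (P _); apply/seteqP; split => [w h j _|w h j]; first exact: h.
by apply: h => /=; rewrite mem_enum.
Qed.

Lemma pr_lam_gt j n : (P [set w | (n < lam j w)%N] = ((1 - rho j) ^+ n)%:E)%E.
Proof.
elim: n => [|n IH].
  rewrite expr0 (_ : [set _ | _] = setT) ?probability_setT//.
  by apply/seteqP; split => // w _ /=; exact: lam1.
have mgt m : measurable [set w | (m < lam j w)%N].
  exact: (measurable_lam_set j [set k | (m < k)%N]).
have : (P [set w | (n < lam j w)%N] =
        P [set w | (n.+1 < lam j w)%N] + P [set w | lam j w = n.+1])%E.
  rewrite -measureU//.
  - congr (P _); apply/seteqP; split => w /=; rewrite [(n < _)%N]leq_eqVlt.
      by move=> /predU1P[->|]; [right|left].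
    by case=> [->|->]; rewrite ?eqxx ?orbT.
  - exact: (measurable_lam_set j [set k | k = n.+1]).
  - by apply/seteqP; split => // w [/= + e]; rewrite e ltnn.
rewrite IH lam_geo//= => h.
have : (P [set w | (n.+1 < lam j w)%N] \is a fin_num)%E by exact: fin_num_measure.
move: h; case: (P _) => // r; rewrite -EFinD => -[h] _.
by congr (_%:E); rewrite exprSr mulrBr mulr1 {1}h addrK.
Qed.

Definition prior (k : 'I_d -> nat) : R :=
  \prod_j ((1 - rho j) ^+ (k j).-1 * rho j).

Lemma prior_gt0 k : 0 < prior k.
Proof.
apply: prodr_gt0 => j _; have /andP[r0 r1] := rho01 j.
by rewrite mulr_gt0// exprn_gt0// subr_gt0.
Qed.

Lemma measurable_change_event k : measurable (change_event lam k).
Proof. exact: (measurable_lam_rect (fun j => [set k j])). Qed.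

Lemma pr_change_event k : (forall j, (1 <= k j)%N) ->
  (P (change_event lam k) = (prior k)%:E)%E.
Proof.
move=> k1; rewrite /change_event (pr_lam_rect (fun j => [set k j])) /prior -prodEFin.
by apply: eq_bigr => j _; rewrite -lam_geo.
Qed.

End ChangePoints.

(** * Change of measure between configurations *)

Lemma measure_finbigcup_le {R : realType} {dO : measure_display}
    {Omega : measurableType dO} (P : probability Omega R) {I : finType}
    (U : I -> set Omega) (A : set Omega) :
  (forall i, measurable (U i)) -> measurable A -> A `<=` \bigcup_i U i ->
  (P A <= \sum_i P (U i))%E.
Proof.
move=> mU mA AU; have IE : [set: I] = [set` enum I].
  by apply/seteqP; split => // i _ /=; rewrite mem_enum.
apply: (@le_trans _ _ (\sum_(i \in [set: I]) P (U i))%E).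
  by apply: content_sub_fsum => //; rewrite IE; exact: finite_seq.
by rewrite IE -fsbig_seq ?enum_uniq// big_enum.
Qed.

(** This sums estimates made per configuration: subadditivity on the left, additivity over the
    disjoint [V i] on the right, so the common factor [r] survives. *)
Lemma measure_bigcup_le {R : realType} {dO : measure_display}
    {Omega : measurableType dO} (P : probability Omega R) {I : countType}
    (U V : I -> set Omega) (r : R) :
  0 <= r -> (forall i, measurable (U i)) -> (forall i, measurable (V i)) ->
  trivIset setT V -> (forall i, P (U i) <= r%:E * P (V i))%E ->
  (P (\bigcup_i U i) <= r%:E * P (\bigcup_i V i))%E.
Proof.
move=> r0 mU mV tV UV.
pose F (W : I -> set Omega) n := if pickle_inv n is Some i then W i else set0.
have FE W : \bigcup_i W i = \bigcup_n F W n.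
  apply/seteqP; split => w.
    by move=> [i _ Wi]; exists (pickle i) => //; rewrite /F pickleK_inv.
  by move=> [n _]; rewrite /F; case: pickle_inv => // i Wi; exists i.
have mF W n : (forall i, measurable (W i)) -> measurable (F W n).
  by move=> mW; rewrite /F; case: pickle_inv.
rewrite (FE U) (FE V) [in leRHS]measure_bigcup//=; last 2 first.
- by move=> n _; apply: mF.
- apply/trivIsetP => n m _ _ nm; rewrite /F.
  case En: (pickle_inv n) => [i|]; last by rewrite set0I.
  case Em: (pickle_inv m) => [j|]; last by rewrite setI0.
  move/trivIsetP: tV; apply => //; apply/eqP => ij; case/eqP: nm.
  have := @pickle_invK I n; have := @pickle_invK I m.
  by rewrite En Em /= ij => <- <-.
under eq_eseriesl do rewrite in_setT.
rewrite -nneseriesZl//.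
apply: (@le_trans _ _ (\sum_(n <oo) P (F U n))%E).
  apply: measure_sigma_subadditive => //.
  - by move=> n; apply: mF.
  - by apply: bigcupT_measurable => n; apply: mF.
apply: lee_nneseries => [n _ _|n _]; first exact: measure_ge0.
by rewrite /F; case: pickle_inv => //; rewrite measure0 mule0.
Qed.

Lemma cond_prE {R : realType} {dO : measure_display}
    {Omega : measurableType dO} (P : probability Omega R) (A B : set Omega) :
  measurable A -> measurable B -> (0 < P B)%E ->
  (P (A `&` B) = P B * cond_pr P B A)%E.
Proof.
move=> mA mB PB0; rewrite /cond_pr.
have : (P B \is a fin_num)%E by exact: fin_num_measure.
have : (P (A `&` B) \is a fin_num)%E by apply: fin_num_measure; exact: measurableI.
move: PB0; case: (P B) => // p p0; case: (P _) => // r _ _.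
rewrite inver gt_eqF -?EFinM//; congr (_%:E).
by rewrite mulrCA divff ?mulr1// gt_eqF.
Qed.

Section Likelihood.
Context {R : realType} {d : nat} (E : {set {set 'I_d}}) {dT : measure_display}
  {T : measurableType dT} (mu : {measure set T -> \bar R})
  (g f : {set 'I_d} -> T -> R) {dO : measure_display}
  {Omega : measurableType dO} (P : probability Omega R)
  (lam : 'I_d -> {RV P >-> nat}) (X : {set 'I_d} -> nat -> {RV P >-> T})
  (rho : 'I_d -> R) (M : R).
Hypotheses
  (dens : forall e, e \in extended_edges E ->
     is_density mu (g e) /\ is_density mu (f e))
  (lam1 : forall j w, (1 <= lam j w)%N)
  (model : observation_model E mu g f P lam X)
  (supM : forall e, e \in extended_edges E ->
     (sup_norm (llr (f e) (g e)) <= M%:E)%E)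
  (lam_indep : mutually_independent P setT lam)
  (rho01 : forall j, 0 < rho j < 1)
  (lam_geo : geometric_prior P lam rho).
Implicit Types (k : 'I_d -> nat) (n t : nat) (e : {set 'I_d}).

Definition obs_seq n : seq ({set 'I_d} * nat) :=
  [seq (e, t) | e <- enum (extended_edges E), t <- iota 1 n].

Lemma obs_seqP n i :
  reflect (obs_index E i /\ (i.2 <= n)%N) (i \in obs_seq n).
Proof.
apply: (iffP allpairsP) => [[[e t] [/= eE ti ->]]|[[iE i1] i2]].
  by move: eE ti; rewrite mem_enum mem_iota add1n ltnS => eE /andP[].
exists i; split; last by case: (i).
  by rewrite mem_enum.
by rewrite mem_iota add1n ltnS i1.
Qed.

Lemma obs_seq_uniq n : uniq (obs_seq n).
Proof.
by apply: allpairs_uniq; rewrite ?enum_uniq ?iota_uniq// => -[? ?] [? ?] _ _.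
Qed.

Definition changed k e t : bool := (min_over k e <= t)%N.

Lemma obs_densityE k e t : obs_density g f k e t = if changed k e t then f e else g e.
Proof. by rewrite /obs_density /changed ltnNge; case: leqP. Qed.

Lemma is_density_obs k e t : e \in extended_edges E ->
  is_density mu (obs_density g f k e t).
Proof. by move=> /dens[? ?]; rewrite obs_densityE; case: ifP. Qed.

(** Exponent, -1, 0 or 1, of [f e / g e] in the density ratio of [X e t] under [k] and [k']. *)
Definition lr_sign k k' e t : R := (changed k e t)%:R - (changed k' e t)%:R.

Definition log_lr e : T -> R := llrR (f e) (g e).

Lemma obs_density_change k k' e t x : e \in extended_edges E ->
  obs_density g f k e t x =
  expR (lr_sign k k' e t * log_lr e x) * obs_density g f k' e t x.
Proof.
move=> eE; have [dg df] := dens eE.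
have [_ _ fE] := llrR_spec df dg (supM eE) x.
rewrite !obs_densityE /lr_sign -/(log_lr e x) /log_lr.
case: ifP => _; case: ifP => _; rewrite /= ?subrr ?mul0r ?expR0 ?mul1r//.
  by rewrite subr0 mul1r mulrC.
by rewrite sub0r mulN1r fE mulrCA -expRD addNr expR0 mulr1.
Qed.

Definition lik_ratio k k' n w : R :=
  \prod_(i <- obs_seq n) expR (lr_sign k k' i.1 i.2 * log_lr i.1 (X i.1 i.2 w)).

Lemma model_rect k n (A : {set 'I_d} * nat -> set T) :
  (forall j, (1 <= k j)%N) -> (forall i, measurable (A i)) ->
  (P (change_event lam k `&` \bigcap_(i in [set` obs_seq n]) (X i.1 i.2 @^-1` A i)) =
  (prior rho k)%:E *
   \big[*%E/1]_(i <- obs_seq n) \int[mu]_(x in A i) (obs_density g f k i.1 i.2 x)%:E)%E.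
Proof.
move=> k1 mA; have PC := pr_change_event lam_indep lam_geo k1.
have PC0 : (0 < P (change_event lam k))%E by rewrite PC lte_fin prior_gt0.
rewrite setIC cond_prE//; last 2 first.
- apply: fin_bigcap_measurable; first exact: finite_seq.
  by move=> i _; rewrite -[X in measurable X]setTI; exact: measurable_funPT.
- exact: measurable_change_event.
have [ind law] := model PC0.
rewrite PC ind//; last 2 first.
- exact: obs_seq_uniq.
- by move=> i /obs_seqP[].
congr (_ * _)%E; rewrite big_seq [RHS]big_seq; apply: eq_bigr => -[e t] /obs_seqP[i _].
exact: law.
Qed.

Lemma measurable_log_lr e : e \in extended_edges E -> measurable_fun setT (log_lr e).
Proof. by move=> /dens[dg df]; exact: measurable_llrR df dg. Qed.

Lemma measurable_lik_ratio k k' n : measurable_fun setT (lik_ratio k k' n).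
Proof.
apply: measurable_prod => i /obs_seqP[[iE _] _].
apply: measurableT_comp => //; apply: measurable_funM => //.
apply: measurableT_comp => //; exact: measurable_log_lr.
Qed.

Lemma lik_ratio_ge0 k k' n w : 0 <= lik_ratio k k' n w.
Proof. by apply: prodr_ge0 => i _; exact: expR_ge0. Qed.

Let C k := change_event lam k.
Let mC k : measurable (C k). Proof. exact: measurable_change_event. Qed.

Definition obs_rect n : set (set Omega) :=
  [set A | exists2 B : {set 'I_d} * nat -> set T, (forall i, measurable (B i)) &
     A = \bigcap_(i in [set` obs_seq n]) (X i.1 i.2 @^-1` B i)].

Lemma measurable_obs_rect n A : obs_rect n A -> measurable A.
Proof.
move=> [B mB ->]; apply: fin_bigcap_measurable; first exact: finite_seq.
by move=> i _; rewrite -[X in measurable X]setTI; exact: measurable_funPT.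
Qed.

Lemma obs_rectI n : setI_closed (obs_rect n).
Proof.
move=> _ _ [B mB ->] [B' mB' ->]; exists (fun i => B i `&` B' i).
  by move=> i; exact: measurableI.
by rewrite -bigcapI; apply: eq_bigcapr => i _; rewrite preimage_setI.
Qed.

Lemma obs_filtration_sub_rect n : obs_filtration E X n `<=` <<s obs_rect n >>.
Proof.
apply: smallest_sub; first exact: smallest_sigma_algebra.
move=> A [i [iE i_n] [B mB <-]]; apply: sub_sigma_algebra.
exists (fun j => if j == i then B else setT); first by move=> j; case: ifP.
rewrite setTI; apply/seteqP; split => [w Bw j _ /=|w /(_ i) /=].
  by case: eqP => [->|].
by rewrite eqxx; apply; exact/obs_seqP.
Qed.

Lemma measurable_obs_filtration n A : obs_filtration E X n A -> measurable A.
Proof.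
move: A; apply: smallest_sub; first exact: sigma_algebra_measurable.
move=> A [i _ [B mB <-]]; exact: measurable_funPT.
Qed.

Lemma integral_lik_ratio_rect k k' n (B : {set 'I_d} * nat -> set T) :
  (forall j, (1 <= k' j)%N) -> (forall i, measurable (B i)) ->
  (\int[P]_(w in C k' `&` \bigcap_(i in [set` obs_seq n]) (X i.1 i.2 @^-1` B i))
     (lik_ratio k k' n w)%:E =
   (prior rho k')%:E *
   \big[*%E/1]_(i <- obs_seq n) \int[mu]_(x in B i) (obs_density g f k i.1 i.2 x)%:E)%E.
Proof.
move=> k'1 mB; rewrite integral_mkcondr.
pose h (i : {set 'I_d} * nat) x : R := \1_(B i) x * expR (lr_sign k k' i.1 i.2 * log_lr i.1 x).
transitivity (\int[P]_(w in C k') (\prod_(i <- obs_seq n) h i (X i.1 i.2 w))%:E)%E.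
  apply: eq_integral => w _; rewrite epatch_indic -EFinM; congr (_%:E).
  rewrite /h big_split/= mulrC; congr (_ * _).
  by apply/esym; exact: (prod_indic_preimage (fun i w => X i.1 i.2 w) (obs_seq_uniq n)).
pose v (i : {set 'I_d} * nat) :=
  fine (\int[mu]_(x in B i) (obs_density g f k i.1 i.2 x)%:E)%E.
have vE i : i \in obs_seq n ->
    (\int[mu]_(x in B i) (obs_density g f k i.1 i.2 x)%:E = (v i)%:E)%E.
  move=> /obs_seqP[[iE _] _]; rewrite /v fineK//.
  by apply: density_fin_num => //; exact: is_density_obs.
rewrite (@ge0_expectation_prod _ _ _ _ _ mu P _ (C k')
  (fun i w => X i.1 i.2 w) (fun i => obs_density g f k' i.1 i.2) (obs_seq n)
  (prior rho k') _ _ _ _ _ _ h v)//.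
- rewrite EFinM; congr (_ * _)%E; rewrite big_seq [RHS]big_seq.
  by rewrite -prodEFin; apply: eq_bigr => i ni; rewrite vE.
- by move=> i /obs_seqP[[iE _] _]; exact: is_density_obs.
- exact: obs_seq_uniq.
- exact/ltW/prior_gt0.
- by move=> A mA; exact: model_rect.
- move=> i /obs_seqP[[iE _] _]; apply: measurable_funM => //.
  apply: measurableT_comp => //; apply: measurable_funM => //.
  exact: measurable_log_lr.
- by move=> i x; rewrite mulr_ge0 ?expR_ge0.
- move=> i ni; rewrite -vE// [RHS]integral_mkcond; apply: eq_integral => x _.
  move: ni => /obs_seqP[[iE _] _].
  by rewrite epatch_indic -mulrA -obs_density_change// EFinM muleC.
Qed.

(** Radon-Nikodym formula on F_n. On rectangles of observations both sides are products of integrals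
    of the same densities; the pi-lambda theorem extends it to F_n. *)
Lemma change_of_measure k k' n A :
  (forall j, (1 <= k j)%N) -> (forall j, (1 <= k' j)%N) ->
  obs_filtration E X n A ->
  (P (C k `&` A) = (prior rho k / prior rho k')%:E *
   \int[P]_(w in C k' `&` A) (lik_ratio k k' n w)%:E)%E.
Proof.
move=> k1 k'1 FA; pose r := prior rho k / prior rho k'.
have r0 : (0 <= r%:E)%E by rewrite lee_fin divr_ge0 ?ltW ?prior_gt0.
pose Q A := (r%:E * \int[P]_(w in C k' `&` A) (lik_ratio k k' n w)%:E)%E.
pose H := [set A | measurable A /\ P (C k `&` A) = Q A].
have mL D : measurable_fun D (fun w => (lik_ratio k k' n w)%:E).
  by apply/measurable_EFinP/measurable_funTS; exact: measurable_lik_ratio.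
have L0 w : (0 <= (lik_ratio k k' n w)%:E)%E by rewrite lee_fin lik_ratio_ge0.
have GH : obs_rect n `<=` H.
  move=> _ [B mB ->]; split; first by apply: (@measurable_obs_rect n); exists B.
  rewrite /Q integral_lik_ratio_rect// model_rect// muleA -EFinM /r mulrVK//.
  by rewrite unitfE gt_eqF// prior_gt0.
have GT : obs_rect n setT.
  by exists (fun=> setT) => //; rewrite bigcapT.
suff: <<s obs_rect n >> `<=` H.
  by move=> /(_ A (obs_filtration_sub_rect FA))[].
apply: lambda_system_subset => //; first exact: obs_rectI.
apply/dynkin_lambda_system; split; first exact: GH.
- move=> B [mB PB]; split; first exact: measurableC.
  have mCB k0 : measurable (C k0 `&` B) by exact: measurableI.
  have mCCB k0 : measurable (C k0 `&` ~` B) by apply: measurableI => //; exact: measurableC.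
  have CE k0 : C k0 = (C k0 `&` B) `|` (C k0 `&` ~` B) by rewrite -setIUr setUv setIT.
  have disj k0 : [disjoint C k0 `&` B & C k0 `&` ~` B].
    by apply/disj_setPS => w [[_ ?] [_]].
  (* The total masses agree, as the whole space is a rectangle; the finite value on [B] is then
     subtracted. *)
  have : (P (C k `&` B) + P (C k `&` ~` B) = Q B + Q (~` B))%E.
    rewrite -measureU//; last by have := disj k; rewrite disj_set2E => /eqP.
    rewrite -CE /Q -ge0_muleDr ?integral_ge0// -ge0_integral_setU// -CE.
    by have := (GH _ GT).2; rewrite /Q !setIT.
  rewrite PB.
  have : Q B \is a fin_num by rewrite -PB fin_num_measure.
  move=> fB /(congr1 (fun z => z - Q B)%E).
  by rewrite ![(Q B + _)%E]addeC !addeK.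
- move=> F tF HF; split; first by apply: bigcupT_measurable => i; have [] := HF i.
  have mF i : measurable (F i) by have [] := HF i.
  have tCF k0 : trivIset setT (fun i => C k0 `&` F i) by exact: trivIset_setIl.
  rewrite /Q !setI_bigcupr measure_bigcup//=; last by move=> i _; exact: measurableI.
  rewrite ge0_integral_bigcup//=; last by move=> i; exact: measurableI.
  rewrite -nneseriesZl//; last by move=> i _; exact: integral_ge0.
  under eq_eseriesl do rewrite in_setT.
  by apply: eq_eseriesr => i _; have [_ ->] := HF i.
Qed.

(** * Exponential moments and Chernoff bounds for the log-likelihood ratio *)

Definition log_lik k k' n w : R :=
  \sum_(i <- obs_seq n) lr_sign k k' i.1 i.2 * log_lr i.1 (X i.1 i.2 w).

Lemma lik_ratioE k k' n w : lik_ratio k k' n w = expR (log_lik k k' n w).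
Proof. by rewrite /log_lik expR_sum. Qed.

Lemma measurable_log_lik k k' n : measurable_fun setT (log_lik k k' n).
Proof.
rewrite /log_lik; under eq_fun do rewrite big_seq big_mkcond.
apply: measurable_sum => i.
have [/obs_seqP[[iE _] _]|_] := boolP (i \in obs_seq n); last exact: measurable_cst.
apply: measurable_funM => //; apply: measurableT_comp => //.
exact: measurable_log_lr.
Qed.

Lemma log_lr_le e x : e \in extended_edges E -> `|log_lr e x| <= M.
Proof.
by move=> eE; have [dg df] := dens eE; have [] := llrR_spec df dg (supM eE) x.
Qed.

Lemma mgf_le_sup k e t (s th : R) : e \in extended_edges E ->
  `|s| <= 1 -> 0 <= th ->
  (\int[mu]_x (expR (th * s * log_lr e x) * obs_density g f k e t x)%:E <=
   (expR (th * M))%:E)%E.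
Proof.
move=> eE s1 th0; have [mD D0 D1] := is_density_obs k t eE.
have -> : ((expR (th * M))%:E =
    \int[mu]_x ((expR (th * M))%:E * (obs_density g f k e t x)%:E))%E.
  rewrite ge0_integralZl// ?D1 ?mule1 ?lee_fin ?expR_ge0//.
    exact/measurable_EFinP.
  by move=> x _; rewrite lee_fin.
apply: ge0_le_integral => //.
- by move=> x _; rewrite lee_fin mulr_ge0 ?expR_ge0.
- apply/measurable_EFinP; apply: measurable_funM => //.
  apply: measurableT_comp => //; apply: measurable_funM => //.
  exact: measurable_log_lr.
- by apply: measurable_funeM; exact/measurable_EFinP.
move=> x _; rewrite -EFinM lee_fin ler_wpM2r// ler_expR -mulrA ler_wpM2l//.
rewrite (le_trans (ler_norm _))// normrM -[leRHS]mul1r ler_pM//.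
exact: log_lr_le.
Qed.

Lemma mgf_unsigned k e t : e \in extended_edges E ->
  (\int[mu]_x (expR (0 * log_lr e x) * obs_density g f k e t x)%:E = 1)%E.
Proof.
move=> eE; have [mD D0 D1] := is_density_obs k t eE.
by under eq_integral do rewrite mul0r expR0 mul1r.
Qed.

Lemma mgf_changed k e t (th : R) : e \in extended_edges E ->
  changed k e t -> `|th| * M <= 2^-1 ->
  (\int[mu]_x (expR (th * log_lr e x) * obs_density g f k e t x)%:E <=
   (expR (th * kl_info mu (f e) (g e) + 2 * th ^+ 2 * M ^+ 2))%:E)%E.
Proof.
move=> eE kt thM; have [dg df] := dens eE.
by rewrite obs_densityE kt; exact: (llrR_mgf df dg (supM eE) thM).
Qed.

(** Exponential Markov inequality, with the moment factorised over observations. The true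
    configuration [k0] is separate from [k] and [k'], because in [pr_bad_lik_one] neither of the
    compared configurations has to be the true one. *)
Lemma chernoff k0 k k' n (th c : R) (b : {set 'I_d} * nat -> R) :
  (forall j, (1 <= k0 j)%N) -> 0 <= th ->
  (forall i, i \in obs_seq n ->
    (\int[mu]_x (expR (th * lr_sign k k' i.1 i.2 * log_lr i.1 x) *
                 obs_density g f k0 i.1 i.2 x)%:E <= (expR (b i))%:E)%E) ->
  (P (C k0 `&` [set w | (c <= log_lik k k' n w)%R]) <=
   (prior rho k0 * expR (\sum_(i <- obs_seq n) b i - th * c))%:E)%E.
Proof.
move=> k01 th0 hb.
pose h (i : {set 'I_d} * nat) x := expR (th * lr_sign k k' i.1 i.2 * log_lr i.1 x).
pose v (i : {set 'I_d} * nat) :=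
  fine (\int[mu]_x (h i x * obs_density g f k0 i.1 i.2 x)%:E)%E.
have mh i : i \in obs_seq n -> measurable_fun setT (h i).
  move=> /obs_seqP[[iE _] _]; apply: measurableT_comp => //.
  by apply: measurable_funM => //; exact: measurable_log_lr.
have h0 i x : 0 <= h i x by exact: expR_ge0.
have vE i : i \in obs_seq n ->
    (\int[mu]_x (h i x * obs_density g f k0 i.1 i.2 x)%:E = (v i)%:E)%E.
  move=> ni; rewrite /v fineK// ge0_fin_numE.
    by apply: (le_lt_trans (hb i ni)); exact: ltry.
  apply: integral_ge0 => x _; rewrite lee_fin mulr_ge0//.
  by move: ni => /obs_seqP[[iE _] _]; have [_ D0 _] := is_density_obs k0 i.2 iE; exact: D0.
have intE : (\int[P]_(w in C k0) (expR (th * log_lik k k' n w))%:E =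
             (prior rho k0 * \prod_(i <- obs_seq n) v i)%:E)%E.
  rewrite -(@ge0_expectation_prod _ _ _ _ _ mu P _ (C k0)
    (fun i w => X i.1 i.2 w) (fun i => obs_density g f k0 i.1 i.2) (obs_seq n)
    (prior rho k0) _ _ _ _ _ _ h v)//.
  - apply: eq_integral => w _; rewrite /log_lik mulr_sumr expR_sum.
    by congr (_%:E); apply: eq_bigr => i _; rewrite mulrA.
  - by move=> i /obs_seqP[[iE _] _]; exact: is_density_obs.
  - exact: obs_seq_uniq.
  - exact/ltW/prior_gt0.
  - by move=> A mA; exact: model_rect.
have mG : measurable [set w | (c <= log_lik k k' n w)%R].
  rewrite -[X in measurable X]setTI; exact: (measurable_fun_le measurableT (measurable_cst c) (measurable_log_lik k k' n)).
have vb : \prod_(i <- obs_seq n) v i <= expR (\sum_(i <- obs_seq n) b i).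
  rewrite expR_sum big_seq [leRHS]big_seq; apply: ler_prod => i ni.
  rewrite -!lee_fin -vE// hb// andbT; apply: integral_ge0 => x _.
  rewrite lee_fin mulr_ge0//.
  by move: ni => /obs_seqP[[iE _] _]; have [_ D0 _] := is_density_obs k0 i.2 iE; exact: D0.
have mL : measurable_fun setT (fun w => expR (th * log_lik k k' n w)).
  apply: measurableT_comp => //; apply: measurable_funM => //.
  exact: measurable_log_lik.
have : ((expR (th * c))%:E * P (C k0 `&` [set w | (c <= log_lik k k' n w)%R]) <=
        (prior rho k0 * expR (\sum_(i <- obs_seq n) b i))%:E)%E.
  apply: (@le_trans _ _ (prior rho k0 * \prod_(i <- obs_seq n) v i)%:E); last first.
    by rewrite lee_fin ler_wpM2l//; exact/ltW/prior_gt0.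
  rewrite -intE -integral_cst//; last exact: measurableI.
  apply: (@le_trans _ _ (\int[P]_(w in C k0 `&` [set w | (c <= log_lik k k' n w)%R])
     (expR (th * log_lik k k' n w))%:E)%E).
    apply: ge0_le_integral => //.
    - exact: measurableI.
    - by move=> w _; rewrite lee_fin expR_ge0.
    - by apply/measurable_EFinP/measurable_funTS.
    - by move=> w [_ cw]; rewrite lee_fin ler_expR ler_wpM2l.
  apply: ge0_subset_integral => //.
  - exact: measurableI.
  - by apply/measurable_EFinP/measurable_funTS.
have : (P (C k0 `&` [set w | (c <= log_lik k k' n w)%R]) \is a fin_num)%E.
  by apply: fin_num_measure; exact: measurableI.
case: (P _) => // r _; rewrite -EFinM !lee_fin mulrC => h1.
by rewrite expRD expRN mulrA ler_pdivlMr ?expR_gt0.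
Qed.

(** * Likelihood ratio of a configuration against its delay on [S] *)

Variable S : {set 'I_d}.
Hypotheses (grE : is_graph E) (S0 : S != finset.set0) (M1 : 1 <= M).

Let M0 : 0 <= M. Proof. exact: le_trans ler01 M1. Qed.

Lemma extended_edge_neq0 e : e \in extended_edges E -> e != finset.set0.
Proof.
rewrite inE => /orP[/grE e2|/imsetP[j _ ->]].
  by rewrite -cards_eq0 e2.
by apply/set0Pn; exists j; rewrite inE.
Qed.

Lemma changedP k e t : e \in extended_edges E ->
  reflect (exists2 j, j \in e & (k j <= t)%N) (changed k e t).
Proof.
move=> /extended_edge_neq0 e0; rewrite /changed; apply: (iffP idP).
  by have [j je ->] := min_over_attained k e0; exists j.
by move=> [j je kt]; apply: leq_trans kt; exact: min_over_le.
Qed.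

Lemma lr_sign_norm k k' e t : `|lr_sign k k' e t| <= 1.
Proof.
by rewrite /lr_sign; case: changed; case: changed; rewrite ?subrr ?subr0 ?sub0r ?normrN ?normr1 ?normr0.
Qed.

Lemma sum_obs_seq n (b : {set 'I_d} -> nat -> R) :
  \sum_(i <- obs_seq n) b i.1 i.2 =
  \sum_(e in extended_edges E) \sum_(t <- iota 1 n) b e t.
Proof.
by rewrite /obs_seq big_allpairs /= big_enum.
Qed.

(** Times start at 1, so only [b.-1] of them precede [b]. *)
Lemma sum_iota_step n b (x y : R) :
  \sum_(t <- iota 1 n) (if (t < b)%N then x else y) =
  x *+ minn n b.-1 + y *+ (n - b.-1).
Proof.
elim: n => [|n IH]; first by rewrite big_nil min0n sub0n !mulr0n addr0.
rewrite -[n.+1]addn1 iotaD big_cat/= IH big_cons big_nil addr0 add1n.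
case: ifPn => nb.
  have -> : minn (n + 1) b.-1 = (minn n b.-1).+1 by lia.
  have -> : (n + 1 - b.-1 = n - b.-1)%N by lia.
  by rewrite mulrSr addrAC.
have -> : minn (n + 1) b.-1 = minn n b.-1 by lia.
have -> : (n + 1 - b.-1 = (n - b.-1).+1)%N by lia.
by rewrite [in RHS]mulrSr addrA.
Qed.

Definition n_edges : R := #|extended_edges E|%:R.

(** Drift of an edge, set to 0 unless it lies inside [S]: exponents can then be bounded edge by edge
    over the whole extended edge set. *)
Definition kl_in e : R := if e \subset S then kl_info mu (f e) (g e) else 0.

Lemma sum_edges_const (x : R) : \sum_(e in extended_edges E) x = n_edges * x.
Proof. by rewrite sumr_const /n_edges mulr_natl. Qed.

Lemma I_infoE : I_info E mu g f S = \sum_(e in extended_edges E) kl_in e.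
Proof. by rewrite /I_info /kl_in -big_mkcondr. Qed.

Lemma kl_in_ge0 e : e \in extended_edges E -> 0 <= kl_in e.
Proof.
move=> eE; have [dg df] := dens eE; rewrite /kl_in; case: ifP => // _.
exact: (kl_info_ge0 df dg (supM eE)).
Qed.

Lemma I_info_ge0 : 0 <= I_info E mu g f S.
Proof. by rewrite I_infoE; apply: sumr_ge0 => e; exact: kl_in_ge0. Qed.

Definition shift m k : 'I_d -> nat := fun j => (k j + (j \in S) * m)%N.

Lemma shift_in m k j : j \in S -> shift m k j = (k j + m)%N.
Proof. by rewrite /shift => ->; rewrite mul1n. Qed.

Lemma shift_notin m k j : j \notin S -> shift m k j = k j.
Proof. by rewrite /shift => /negbTE ->; rewrite mul0n addn0. Qed.

Lemma min_over_shift m k : min_over (shift m k) S = (min_over k S + m)%N.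
Proof.
have [i iS E1] := min_over_attained (shift m k) S0.
have [j jS E2] := min_over_attained k S0.
have := min_over_le (shift m k) jS; have := min_over_le k iS.
rewrite E1 E2 !shift_in//; lia.
Qed.

Lemma log_lik_shift_tail k b m (th c : R) :
  (forall j, (1 <= k j <= b)%N) -> 0 <= th -> th * M <= 2^-1 ->
  (P (C k `&` [set w | (c <= log_lik k (shift m.+1 k) (min_over k S + m) w)%R]) <=
   (prior rho k * expR (n_edges * (th * M) * b%:R +
      m.+1%:R * (th * I_info E mu g f S + n_edges * (2 * th ^+ 2 * M ^+ 2)) - th * c))%:E)%E.
Proof.
move=> k1b th0 thM; set n := (min_over k S + m)%N; set k' := shift _ _.
have k1 j : (1 <= k j)%N by have /andP[] := k1b j.
have kb j : (k j <= b)%N by have /andP[] := k1b j.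
have [j0 j0S kj0] := min_over_attained k S0.
(* Before [b] only boundedness of the log-ratio is used. From [b] on every vertex has changed under
   [k]; at most [m.+1] such times remain up to [n], since the minimum of [k] over [S] is at most
   [b]. *)
pose be e t : R := if (t < b)%N then th * M else th * kl_in e + 2 * th ^+ 2 * M ^+ 2.
have z0 : 0 <= 2 * th ^+ 2 * M ^+ 2 by rewrite mulr_ge0 ?sqr_ge0// mulr_ge0 ?sqr_ge0.
apply: (le_trans (@chernoff k k k' n th c (fun i => be i.1 i.2) k1 th0 _)).
  move=> [e t] /obs_seqP[[/= eE t1] tn]; rewrite /be /=; case: ltnP => tb.
    by apply: mgf_le_sup => //; exact: lr_sign_norm.
  have ke : changed k e t.
    apply/changedP => //; have /set0Pn[j je] := extended_edge_neq0 eE.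
    by exists j => //; exact: leq_trans tb.
  rewrite /lr_sign ke /kl_in; have [eS|/subsetPn[j je jS]] := boolP (e \subset S).
    (* Delaying by [m.+1], not [m], puts the first change in [S] at [n + 1], so edges inside [S] are
       unchanged under [k'] at every observed time. *)
    have -> : changed k' e t = false.
      apply/negP => /changedP-/(_ eE)[j je]; have jS := fintype.subsetP eS j je.
      rewrite /k' shift_in// => /leq_trans/(_ tn).
      by rewrite /n addnS ltn_add2r ltnNge min_over_le.
    by rewrite subr0 mulr1; apply: mgf_changed => //; rewrite ger0_norm.
  have -> : changed k' e t.
    by apply/changedP => //; exists j => //; rewrite /k' shift_notin// (leq_trans (kb j)).
  by rewrite subrr mulr0 mgf_unsigned// lee_fin add0r -[leLHS]expR0 ler_expR.
rewrite lee_fin ler_wpM2l//; first exact/ltW/prior_gt0.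
rewrite ler_expR lerB// sum_obs_seq.
set z := 2 * th ^+ 2 * M ^+ 2 in be z0 *.
have -> : n_edges * (th * M) * b%:R + m.+1%:R * (th * I_info E mu g f S + n_edges * z) =
    \sum_(e in extended_edges E) (th * M * b%:R + m.+1%:R * (th * kl_in e + z)).
  by rewrite I_infoE big_split/= sum_edges_const -mulr_sumr big_split/= sum_edges_const -mulr_sumr; ring.
apply: ler_sum => e eE.
rewrite sum_iota_step lerD//.
  rewrite -[leLHS]mulr_natr ler_wpM2l ?mulr_ge0// ler_nat; lia.
rewrite mulr_natl; apply: ler_wpMn2l.
  by rewrite addr_ge0// mulr_ge0// kl_in_ge0.
by rewrite /n kj0; have := kb j0; have := k1 j0; lia.
Qed.

(** * Early stopping is a false alarm for delayed change points *)

Let qS := q_info rho S.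
Let phi := lam_min (fun j => lam j) S.

Lemma expR_q_info m : expR (- (qS * m%:R)) = \prod_(j in S) (1 - rho j) ^+ m.
Proof.
rewrite /qS /q_info mulNr opprK mulr_suml expR_sum; apply: eq_bigr => j _.
have /andP[_ r1] := rho01 j.
by rewrite mulrC expRM_natl lnK ?posrE ?subr_gt0.
Qed.

Lemma prior_shift m k : (forall j, (1 <= k j)%N) ->
  prior rho (shift m k) = prior rho k * expR (- (qS * m%:R)).
Proof.
move=> k1; rewrite expR_q_info [X in _ * X]big_mkcond /prior -big_split/=.
apply: eq_bigr => j _; rewrite /shift; case: ifP => _.
  have -> : ((k j + 1 * m).-1 = (k j).-1 + m)%N by have := k1 j; lia.
  by rewrite exprD -!mulrA; congr (_ * _); rewrite mulrC.
by rewrite mul0n addn0 mulr1.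
Qed.

Lemma phi_change_event k w : C k w -> phi w = min_over k S.
Proof.
move=> kw; rewrite /phi /lam_min (_ : (fun j => _) = k)//.
by apply/funext => j; exact: kw.
Qed.

Lemma phi_gt0 w : (0 < phi w)%N.
Proof. by have [j _ E1] := min_over_attained (fun j => lam j w) S0; rewrite /phi /lam_min E1. Qed.

Lemma measurable_phi_pred (A : set nat) : measurable [set w | A (phi w)].
Proof. exact: (measurable_lam_pred lam (fun k => A (min_over k S))). Qed.

Lemma lr_signN k k' e t : lr_sign k' k e t = - lr_sign k k' e t.
Proof. by rewrite /lr_sign opprB. Qed.

Lemma lik_ratioV k k' n w : lik_ratio k' k n w = expR (- log_lik k k' n w).
Proof.
rewrite lik_ratioE /log_lik -sumrN; congr expR; apply: eq_bigr => i _.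
by rewrite lr_signN mulNr.
Qed.

(** Where the log-ratio is at most [c], the reversed ratio is at least [exp (- c)]. Integrating it
    on that event therefore recovers the probability up to the factor [exp c]. *)
Lemma pr_change_event_low k k' n (c : R) A :
  (forall j, (1 <= k j)%N) -> (forall j, (1 <= k' j)%N) ->
  obs_filtration E X n A ->
  (P (C k `&` A `&` [set w | (log_lik k k' n w <= c)%R]) <=
   (expR c * (prior rho k / prior rho k'))%:E * P (C k' `&` A))%E.
Proof.
move=> k1 k'1 FA; have mA := measurable_obs_filtration FA.
set G := [set w | _].
have mG : measurable G.
  rewrite -[G]setTI; exact: (measurable_fun_le measurableT (measurable_log_lik k k' n) (measurable_cst c)).
have pk := prior_gt0 rho01 k; have pk' := prior_gt0 rho01 k'.
have mCA : measurable (C k `&` A) by exact: measurableI.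
have ppV : prior rho k / prior rho k' * (prior rho k' / prior rho k) = 1.
  by field; rewrite !gt_eqF.
rewrite (change_of_measure k'1 k1 FA) muleA -EFinM -mulrA ppV mulr1.
have mL D : measurable_fun D (fun w => (lik_ratio k' k n w)%:E).
  by apply/measurable_EFinP/measurable_funTS; exact: measurable_lik_ratio.
apply: (@le_trans _ _ ((expR c)%:E * \int[P]_(w in C k `&` A `&` G) (lik_ratio k' k n w)%:E)%E); last first.
  rewrite lee_pmul2l//; last by rewrite lte_fin expR_gt0.
  apply: ge0_subset_integral => //; first exact: measurableI.
  by move=> w _; rewrite lee_fin lik_ratio_ge0.
rewrite -ge0_integralZl//; last 2 first.
- exact: measurableI.
- by move=> w _; rewrite lee_fin lik_ratio_ge0.
rewrite -[leLHS]mul1e -integral_cst; last exact: measurableI.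
apply: ge0_le_integral => //.
- exact: measurableI.
- by apply: measurable_funeM; exact: mL.
- move=> w [_ Gw]; rewrite -EFinM lee_fin lik_ratioV -expRD -[leLHS]expR0 ler_expR.
  by rewrite subr_ge0.
Qed.

Section StoppingTime.
Variable tau : Omega -> \bar R.
Hypothesis tau_stop : is_stopping_time (obs_filtration E X) tau.

Lemma stopping_cases w : tau w = +oo%E \/ exists n : nat, tau w = n%:R%:E.
Proof. by have [] := tau_stop. Qed.

Lemma measurable_stop_le n : measurable [set w | (tau w <= n%:R%:E)%E].
Proof. by have [_ /(_ n)] := tau_stop; exact: measurable_obs_filtration. Qed.

Lemma measurable_stop_le_phi m : measurable [set w | (tau w <= (phi w + m)%:R%:E)%E].
Proof.
rewrite (_ : [set _ | _] = \bigcup_n ([set w | phi w = n] `&` [set w | (tau w <= (n + m)%:R%:E)%E])).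
  apply: bigcupT_measurable => n; apply: measurableI; last exact: measurable_stop_le.
  exact: (measurable_phi_pred [set k | k = n]).
apply/seteqP; split => [w h|w [n _ [/= <-]]//].
by exists (phi w).
Qed.

Lemma stop_lt_phi w : (tau w < (phi w)%:R%:E)%E = (tau w <= (phi w).-1%:R%:E)%E.
Proof.
have [->|[n ->]] := stopping_cases w; first by rewrite ltNge leey leye_eq.
by rewrite lte_fin lee_fin ltr_nat ler_nat -[in LHS](prednK (phi_gt0 w)) ltnS.
Qed.

Lemma measurable_stop_lt_phi : measurable [set w | (tau w < (phi w)%:R%:E)%E].
Proof.
rewrite (_ : [set _ | _] = \bigcup_n ([set w | phi w = n] `&` [set w | (tau w <= n.-1%:R%:E)%E])).
  apply: bigcupT_measurable => n; apply: measurableI; last exact: measurable_stop_le.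
  exact: (measurable_phi_pred [set k | k = n]).
apply/seteqP; split => [w /= h|w [n _ [/= <-]]]; last by rewrite -stop_lt_phi.
by exists (phi w) => //=; rewrite -stop_lt_phi.
Qed.

(** The three terms pay for a change point beyond [b], for a log-ratio of at least [c], and for the
    change of measure that turns early stopping into a false alarm. *)
Lemma stopping_early (a : R) b m (th c : R) :
  (P [set w | (tau w < (phi w)%:R%:E)%E] <= a%:E)%E ->
  0 <= th -> th * M <= 2^-1 ->
  (P [set w | ((phi w)%:R%:E <= tau w <= (phi w + m)%:R%:E)%E] <=
   (\sum_j (1 - rho j) ^+ b +
    expR (n_edges * (th * M) * b%:R +
      m.+1%:R * (th * I_info E mu g f S + n_edges * (2 * th ^+ 2 * M ^+ 2)) - th * c) +
    expR (c + qS * m.+1%:R) * a)%:E)%E.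
Proof.
move=> tau_a th0 thM.
pose I := {ffun 'I_d -> nat}; pose ok (k : I) := forall j, (1 <= k j <= b)%N.
have ok1 (k : I) : ok k -> forall j, (1 <= k j)%N by move=> h j; have /andP[] := h j.
pose n (k : I) := (min_over k S + m)%N.
pose B0 j := [set w | (b < lam j w)%N].
pose LL (k : I) := log_lik k (shift m.+1 k) (n k).
pose U1 (k : I) := if `[< ok k >] then C k `&` [set w | (c <= LL k w)%R] else set0.
pose A (k : I) := [set w | (tau w <= (n k)%:R%:E)%E].
pose U2 (k : I) := if `[< ok k >] then C k `&` A k `&` [set w | (LL k w <= c)%R] else set0.
set r1 := expR (_ - th * c); set r2 := expR (c + _).
have r10 : 0 <= r1 by exact: expR_ge0.
have r20 : 0 <= r2 by exact: expR_ge0.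
have mB0 j : measurable (B0 j) by exact: (measurable_lam_set lam j [set l | (b < l)%N]).
have mLL (k : I) : measurable_fun setT (LL k) by exact: measurable_log_lik.
have mA (k : I) : measurable (A k) by exact: measurable_stop_le.
have mU1 (k : I) : measurable (U1 k).
  rewrite /U1; case: asboolP => [okk|_] //; apply: measurableI => //.
  rewrite -[X in measurable X]setTI.
  exact: (measurable_fun_le measurableT (measurable_cst c) (mLL k)).
have mU2 (k : I) : measurable (U2 k).
  rewrite /U2; case: asboolP => [okk|_] //; apply: measurableI; first exact: measurableI.
  rewrite -[X in measurable X]setTI.
  exact: (measurable_fun_le measurableT (mLL k) (measurable_cst c)).
(* Image of [U2 k] under the delay. These events are disjoint since [shift] is injective, and on
   [V2 k] the change comes at [n k + 1], after [tau]. Together they lie in the false alarm event, of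
   probability at most [a]. *)
pose V2 (k : I) := if `[< ok k >] then C (shift m.+1 k) `&` A k else set0.
have mV2 (k : I) : measurable (V2 k).
  by rewrite /V2; case: asboolP => [okk|_] //; apply: measurableI.
have mD : measurable [set w | ((phi w)%:R%:E <= tau w <= (phi w + m)%:R%:E)%E].
  rewrite (_ : [set _ | _] = ~` [set w | (tau w < (phi w)%:R%:E)%E] `&`
      [set w | (tau w <= (phi w + m)%:R%:E)%E]).
    by apply: measurableI; [apply: measurableC; exact: measurable_stop_lt_phi|
                            exact: measurable_stop_le_phi].
  apply/seteqP; split => w /=; first by move=> /andP[h ->]; rewrite leNgt in h; split => //; apply/negP.
  by move=> [/negP]; rewrite -leNgt => -> ->.
have E1 : (P (\bigcup_(k : I) U1 k) <= r1%:E)%E.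
  rewrite -[leRHS]mule1; apply: (@le_trans _ _ (r1%:E * P (\bigcup_(k : I) C k))%E).
    apply: measure_bigcup_le => //.
    - apply/trivIsetP => k k' _ _ /eqP kk'; apply/seteqP; split => // w [kw k'w].
      by apply: kk'; apply/ffunP => j; rewrite -kw -k'w.
    move=> k; rewrite /U1; case: asboolP => [okk|_]; last first.
      by rewrite measure0 mule_ge0// lee_fin.
    rewrite (pr_change_event lam_indep lam_geo); last exact: ok1.
    by rewrite -EFinM mulrC; exact: log_lik_shift_tail.
  rewrite lee_wpmul2l ?lee_fin// probability_le1//.
  by apply: (countable_bigcupT_measurable (countableP _)) => k.
have E2 : (P (\bigcup_(k : I) U2 k) <= (r2 * a)%:E)%E.
  rewrite EFinM; apply: (@le_trans _ _ (r2%:E * P (\bigcup_(k : I) V2 k))%E).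
    apply: measure_bigcup_le => //.
    - apply/trivIsetP => k k' _ _ /eqP kk'; apply/seteqP; split => // w.
      rewrite /V2; do 2 case: asboolP => _; rewrite ?set0I ?setI0// => -[[kw _] [k'w _]].
      apply: kk'; apply/ffunP => j; have := kw j; rewrite (k'w j) /shift => /eqP.
      by rewrite eqn_add2r => /eqP.
    move=> k; rewrite /U2 /V2; case: asboolP => [okk|_]; last first.
      by rewrite measure0 mule0.
    apply: (le_trans (@pr_change_event_low k (shift m.+1 k) (n k) c (A k) _ _ _)).
    - exact: ok1.
    - by move=> j; rewrite /shift ltn_addr// ok1.
    - by have [_] := tau_stop; exact.
    rewrite lee_wpmul2r// lee_fin /r2 expRD ler_wpM2l ?expR_ge0//.
    rewrite prior_shift; last exact: ok1.
    by rewrite invfM mulrA divff ?mul1r ?gt_eqF ?prior_gt0// -expRN opprK.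
  rewrite lee_wpmul2l ?lee_fin//; apply: le_trans tau_a.
  apply: le_measure; rewrite ?inE.
  - exact: (countable_bigcupT_measurable (countableP _)).
  - exact: measurable_stop_lt_phi.
  move=> w [k _]; rewrite /V2; case: asboolP => [okk|//] [kw Aw] /=.
  rewrite (phi_change_event kw) min_over_shift; apply: (le_lt_trans Aw).
  by rewrite lte_fin ltr_nat /n addnS.
pose W (i : 'I_d + bool) := match i with inl j => B0 j | inr true => \bigcup_(k : I) U1 k
  | inr false => \bigcup_(k : I) U2 k end.
have mW i : measurable (W i).
  by case: i => [j|[]] //=; exact: (countable_bigcupT_measurable (countableP _)).
have DW : [set w | ((phi w)%:R%:E <= tau w <= (phi w + m)%:R%:E)%E] `<=` \bigcup_i W i.
  move=> w /= /andP[phi_le le_phi].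
  have [[j bj]|small] := pselect (exists j, (b < lam j w)%N); first by exists (inl j).
  pose k : I := [ffun j => lam j w].
  have kw : C k w by move=> j; rewrite ffunE.
  have okk : ok k.
    move=> j; rewrite ffunE lam1/= leqNgt; apply/negP => bj; apply: small.
    by exists j.
  have Aw : A k w by rewrite /A /n /= -(phi_change_event kw).
  have [cL|Lc] := leP c (LL k w).
    by exists (inr true) => //; exists k => //; rewrite /U1 asboolT.
  by exists (inr false) => //; exists k => //; rewrite /U2 asboolT//; split => //; exact: ltW.
apply: (le_trans (measure_finbigcup_le P mW mD DW)).
rewrite big_sumType/= big_bool/= 2!EFinD -addeA; apply: leeD; last exact: leeD.
by rewrite -sumEFin; apply: lee_sum => j _; rewrite (pr_lam_gt lam1 lam_geo).
Qed.

End StoppingTime.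

(** * The threshold rule *)

Lemma obs_filtrationI n A B : obs_filtration E X n A -> obs_filtration E X n B ->
  obs_filtration E X n (A `&` B).
Proof. exact: (@measurableI _ (g_sigma_algebraType _)). Qed.

Lemma obs_filtrationC n A : obs_filtration E X n A -> obs_filtration E X n (~` A).
Proof. exact: (@measurableC _ (g_sigma_algebraType _)). Qed.

Lemma obs_filtration_bigcup n (A : nat -> set Omega) :
  (forall i, obs_filtration E X n (A i)) -> obs_filtration E X n (\bigcup_i A i).
Proof. exact: (@bigcupT_measurable _ (g_sigma_algebraType _)). Qed.

Lemma obs_filtration_fin_bigcap n {I : finType} (A : I -> set Omega) :
  (forall i, obs_filtration E X n (A i)) -> obs_filtration E X n (\bigcap_i A i).
Proof.
move=> FA; apply: (@fin_bigcap_measurable _ (g_sigma_algebraType _)) => // i _.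
exact: FA.
Qed.

Lemma obs_filtration_le n m : (n <= m)%N ->
  obs_filtration E X n `<=` obs_filtration E X m.
Proof.
move=> nm; apply: sub_sigma_algebra2 => A [i [iE i_n] Ai]; exists i => //.
by split => //; exact: leq_trans nm.
Qed.

Lemma obs_filtration_log_lik k k' n (c : R) :
  obs_filtration E X n [set w | log_lik k k' n w <= c].
Proof.
pose G := \bigcup_(i in [set i | obs_index E i /\ (i.2 <= n)%N])
        preimage_set_system setT (X i.1 i.2 : Omega -> T) measurable.
pose Z := g_sigma_algebraType G.
have mX i : i \in obs_seq n -> measurable_fun setT (X i.1 i.2 : Z -> T).
  move=> /obs_seqP iE _ B mB; rewrite setTI; apply: sub_sigma_algebra.
  by exists i => //; exists B => //; rewrite setTI.
have mL : measurable_fun setT (log_lik k k' n : Z -> R).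
  rewrite /log_lik; under eq_fun do rewrite big_seq big_mkcond.
  apply: measurable_sum => i.
  have [ni|_] := boolP (i \in obs_seq n); last exact: measurable_cst.
  apply: measurable_funM => //; apply: measurableT_comp; last exact: mX.
  by move: ni => /obs_seqP[[iE _] _]; exact: measurable_log_lr.
have := measurable_fun_le measurableT mL (measurable_cst c).
by rewrite setTI.
Qed.

Variable post : nat -> Omega -> R.
Hypothesis postP : forall n, (1 <= n)%N ->
  is_cond_pr P (obs_filtration E X n) [set w | (phi w <= n)%N] (post n).

Lemma measurable_phi_le n : measurable [set w | (phi w <= n)%N].
Proof. exact: (measurable_phi_pred [set k | (k <= n)%N]). Qed.

Lemma integral_post n A : (1 <= n)%N -> obs_filtration E X n A ->
  P.-integrable A (EFin \o post n) /\
  (\int[P]_(w in A) (post n w)%:E = P ([set w | (phi w <= n)%N] `&` A))%E.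
Proof.
move=> n1 FA; have [_ ipost ->//] := postP n1; split => //.
by apply: integrableS ipost => //; exact: measurable_obs_filtration FA.
Qed.

Lemma post_ge_pr n A (x : R) : (1 <= n)%N -> obs_filtration E X n A ->
  (forall w, A w -> x <= post n w) ->
  (x%:E * P A <= P ([set w | (phi w <= n)%N] `&` A))%E.
Proof.
move=> n1 FA xpost; have [ip <-] := integral_post n1 FA.
have mA := measurable_obs_filtration FA.
rewrite -integral_cst//; apply: le_integral => //.
  by apply: finite_measure_integrable_cst.
by move=> w; rewrite inE => Aw; rewrite lee_fin; exact: xpost.
Qed.

Lemma post_le_pr n A (x : R) : (1 <= n)%N -> obs_filtration E X n A ->
  (forall w, A w -> post n w <= x) ->
  (P ([set w | (phi w <= n)%N] `&` A) <= x%:E * P A)%E.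
Proof.
move=> n1 FA xpost; have [ip <-] := integral_post n1 FA.
have mA := measurable_obs_filtration FA.
rewrite -integral_cst//; apply: le_integral => //.
  by apply: finite_measure_integrable_cst.
by move=> w; rewrite inE => Aw; rewrite lee_fin; exact: xpost.
Qed.

Section Threshold.
Variable a : R.
Hypothesis a01 : 0 < a < 1.
Let tau := tau_threshold post a.

Lemma tau_threshold_leP w n : (tau w <= n%:R%:E)%E <->
  exists2 k : nat, (1 <= k <= n)%N & 1 - a <= post k w.
Proof.
split => [tn|[k /andP[k1 kn] pk]]; last first.
  apply: (@le_trans _ _ k%:R%:E); last by rewrite lee_fin ler_nat.
  by apply: ereal_inf_lbound; exists k.
apply: contrapT => H; move: tn; apply/negP; rewrite -ltNge.
apply: (@lt_le_trans _ _ n.+1%:R%:E); first by rewrite lte_fin ltr_nat.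
apply: le_ereal_inf_tmp => _ [k [k1 pk] <-]; rewrite lee_fin ler_nat ltnNge.
by apply/negP => kn; apply: H; exists k => //; rewrite k1.
Qed.

Lemma tau_threshold_cases w : tau w = +oo%E \/ exists n : nat, tau w = n%:R%:E.
Proof.
have [H|H] := pselect (exists k : nat, (1 <= k)%N && (1 - a <= post k w)); last first.
  left; apply/ereal_inf_pinfty => x [k [k1 pk] _].
  by exfalso; apply: H; exists k; rewrite k1.
right; exists (ex_minn H); case: ex_minnP => k /andP[k1 pk] kmin.
apply/eqP; rewrite eq_le; apply/andP; split.
  by apply: ereal_inf_lbound; exists k.
apply: le_ereal_inf_tmp => _ [l [l1 pl] <-]; rewrite lee_fin ler_nat.
by apply: kmin; rewrite l1.
Qed.

Lemma tau_threshold_stop : is_stopping_time (obs_filtration E X) tau.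
Proof.
split => [|n]; first exact: tau_threshold_cases.
rewrite (_ : [set _ | _] =
    \bigcup_k (if (1 <= k <= n)%N then [set w | 1 - a <= post k w] else set0)); last first.
  apply/seteqP; split => w /=.
    by move=> /tau_threshold_leP[k kn pk]; exists k => //; rewrite kn.
  move=> [k _]; case: ifPn => // kn pk; apply/tau_threshold_leP.
  by exists k.
apply: obs_filtration_bigcup => k; case: ifPn => [/andP[k1 kn]|_]; last first.
  exact: (@measurable0 _ (g_sigma_algebraType _)).
apply: (obs_filtration_le kn); have [+ _ _] := postP k1.
move=> /(_ `[1 - a, +oo[%classic (measurable_itv _)).
by congr (obs_filtration _ _ _ _); apply/seteqP; split => w /=; rewrite in_itv/= andbT.
Qed.

(** Split by the value of [tau]: the event [tau = n] is in F_n and the posterior there is at least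
    [1 - a], so no change by [n] has conditional probability at most [a]. An infinite [tau] raises
    no false alarm. *)
Lemma tau_threshold_false_alarm : (P [set w | (tau w < (phi w)%:R%:E)%E] <= a%:E)%E.
Proof.
have /andP[a0 a1] := a01.
pose V n := [set w | tau w = n%:R%:E].
pose U n := V n `&` ~` [set w | (phi w <= n)%N].
have VE n : V n = [set w | (tau w <= n%:R%:E)%E] `&` ~` (\bigcup_(i in `I_n) [set w | (tau w <= i%:R%:E)%E]).
  apply/seteqP; split => w; rewrite /V/=.
    move=> tn; split; rewrite ?tn// => -[i /= i_n]; rewrite tn lee_fin ler_nat leqNgt i_n//.
  move=> [tn nt]; apply/eqP; rewrite eq_le tn leNgt/=; apply/negP => nt'.
  have [|[i ti]] := tau_threshold_cases w.
    by move=> tw; rewrite tw leye_eq in tn.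
  by apply: nt; exists i; rewrite /= ?ti//; rewrite ti lte_fin ltr_nat in nt'.
have FV n : obs_filtration E X n (V n).
  rewrite VE; apply: obs_filtrationI; first by have [_] := tau_threshold_stop; exact.
  apply: obs_filtrationC; rewrite bigcup_mkcond; apply: obs_filtration_bigcup => i.
  case: ifPn => [|_]; last exact: (@measurable0 _ (g_sigma_algebraType _)).
  rewrite inE/= => i_n; apply: (obs_filtration_le (ltnW i_n)).
  by have [_] := tau_threshold_stop; exact.
have mV n : measurable (V n) by exact: measurable_obs_filtration (FV n).
have mphi n : measurable (~` [set w | (phi w <= n)%N]).
  by apply: measurableC; exact: measurable_phi_le.
have mU n : measurable (U n) by apply: measurableI.
rewrite (_ : [set _ | _] = \bigcup_n U n); last first.
  apply/seteqP; split => w /=.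
    have [->|[n tn]] := tau_threshold_cases w; first by rewrite ltNge leey.
    rewrite tn lte_fin ltr_nat => nphi; exists n => //; split => //=.
    by apply/negP; rewrite -ltnNge.
  move=> [n _ [/= -> /negP]]; rewrite -ltnNge => h.
  by rewrite lte_fin ltr_nat.
rewrite -[leRHS]mule1; apply: (@le_trans _ _ (a%:E * P (\bigcup_n V n))%E); last first.
  apply: lee_wpmul2l; first by rewrite lee_fin ltW.
  by apply: probability_le1; exact: bigcupT_measurable.
apply: measure_bigcup_le => //; first exact: ltW.
  apply/trivIsetP => i j _ _ /eqP ij; apply/seteqP; split => // w [Vi Vj].
  by apply: ij; move: Vi; rewrite /V/= Vj => -[] /eqP; rewrite eqr_nat => /eqP.
(* [postP] starts at [n = 1]; the value 0 is never taken, because the infimum runs over positive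
   times. *)
move=> n; have [->|n0] := posnP n.
  have -> : U 0%N = set0.
    apply/seteqP; split => // w [/= t0 _].
    by have /tau_threshold_leP[[|k]//] : (tau w <= 0%:R%:E)%E by rewrite t0.
  by rewrite measure0 mule_ge0// lee_fin ltW.
have := post_ge_pr (x := 1 - a) n0 (FV n).
(* The threshold is crossed at some [k <= n], and [k < n] would make [tau] smaller than [n]. *)
have h w : V n w -> 1 - a <= post n w.
  move=> Vw; have /tau_threshold_leP[k /andP[k1 kn] pk] : (tau w <= n%:R%:E)%E by rewrite Vw.
  suff <- : k = n by [].
  apply/eqP; rewrite eqn_leq kn/=; have : (tau w <= k%:R%:E)%E.
    by apply/tau_threshold_leP; exists k => //; rewrite k1/=.
  by rewrite Vw lee_fin ler_nat.
move=> /(_ h); have mle := measurable_phi_le n.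
have : (P (V n) = P ([set w | (phi w <= n)%N] `&` V n) + P (U n))%E.
  rewrite -measureU//; last 2 first.
  - exact: measurableI.
  - by apply/seteqP; split => // w [[? ?] [_]].
  by congr (P _); rewrite /U [X in _ `|` X]setIC -setIUl setUv setTI.
have : (P (V n) \is a fin_num)%E by exact: fin_num_measure.
have : (P (U n) \is a fin_num)%E by exact: fin_num_measure.
have : (P ([set w | (phi w <= n)%N] `&` V n) \is a fin_num)%E.
  by apply: fin_num_measure; exact: measurableI.
case: (P (_ `&` _)) => // x _; case: (P (U n)) => // y _; case: (P (V n)) => // z _.
rewrite -EFinD => -[->]; rewrite -!EFinM !lee_fin; clear M0 M1; lra.
Qed.

(** * Posterior odds of no change, compared configuration by configuration outside [S] *)

Definition glue k c : 'I_d -> nat := fun j => if j \in S then k j else c j.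

Definition prior_in k : R := \prod_(j in S) ((1 - rho j) ^+ (k j).-1 * rho j).

Lemma prior_in_gt0 k : 0 < prior_in k.
Proof.
apply: prodr_gt0 => j _; have /andP[r0 r1] := rho01 j.
by rewrite mulr_gt0// exprn_gt0// subr_gt0.
Qed.

(** The quotient [prior rho c / prior_in c] is the prior mass of the coordinates outside [S]; the
    exponential is the geometric tail of those inside. *)
Lemma pr_late_glue c n : (forall j, (1 <= c j)%N) ->
  (P [set w | forall j, (if j \in S then [set l | (n < l)%N] else [set c j]) (lam j w)] =
   (expR (- (qS * n%:R)) * (prior rho c / prior_in c))%:E)%E.
Proof.
move=> c1.
rewrite (pr_lam_rect lam_indep (fun j => if j \in S then [set l | (n < l)%N] else [set c j])).
rewrite (eq_bigr (fun j => (if j \in S then (1 - rho j) ^+ n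
   else (1 - rho j) ^+ (c j).-1 * rho j)%:E)); last first.
  by move=> j _; case: ifP => _; [exact: (pr_lam_gt lam1 lam_geo)|exact: lam_geo].
rewrite prodEFin; congr (_%:E).
have -> : prior rho c / prior_in c = \prod_(j | j \notin S) ((1 - rho j) ^+ (c j).-1 * rho j).
  by rewrite /prior (bigID (mem S))/= -/(prior_in c) [prior_in c * _]mulrC mulfK// gt_eqF// prior_in_gt0.
rewrite expR_q_info [LHS](bigID (mem S))/=; congr (_ * _).
  by apply: eq_bigr => j ->.
by apply: eq_bigr => j /negbTE ->.
Qed.

Section Late.
Variables (k : 'I_d -> nat) (n : nat) (l : R) (A : set Omega).
Hypotheses (k1 : forall j, (1 <= k j)%N) (FA : obs_filtration E X n A)
  (kn : (min_over k S <= n)%N).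

(* Up to time [n] only [minn (c j) n.+1] matters, so that finitely many values
   of the change points outside [S] suffice. *)
Definition frozen (c : {ffun 'I_d -> 'I_n.+1}) : 'I_d -> nat := fun j => (c j).+1.

(** For every frozen configuration outside [S], the data favour [k] on [S] over no change in [S] by
    time [n], by at least [l] on the log scale. Quantifying over all of them keeps the event in
    F_n. *)
Definition good_lik := \bigcap_(c : {ffun 'I_d -> 'I_n.+1})
  [set w | log_lik (glue (fun=> n.+1) (frozen c)) (glue k (frozen c)) n w <= - l].

Lemma obs_filtration_good_lik : obs_filtration E X n good_lik.
Proof. by apply: obs_filtration_fin_bigcap => c; exact: obs_filtration_log_lik. Qed.

Let B := A `&` good_lik.
Let FB : obs_filtration E X n B.
Proof. by apply: obs_filtrationI => //; exact: obs_filtration_good_lik. Qed.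
Let mB : measurable B. Proof. exact: measurable_obs_filtration FB. Qed.

Lemma good_lik_le h c w : good_lik w -> (forall j, (1 <= c j)%N) ->
  (forall j, j \in S -> (n < h j)%N) -> (forall j, j \notin S -> h j = c j) ->
  log_lik h (glue k c) n w <= - l.
Proof.
move=> Gw c1 hS hN.
pose c' : {ffun 'I_d -> 'I_n.+1} := [ffun j => inord (minn (c j) n.+1).-1].
have c'E j : frozen c' j = minn (c j) n.+1.
  rewrite /frozen ffunE inordK; have := c1 j; lia.
have := Gw c' Logic.I; rewrite /=; congr (_ <= _); apply/esym; rewrite /log_lik.
have ext l1 l2 e t : (t <= n)%N -> e \in extended_edges E ->
    (forall j, minn (l1 j) n.+1 = minn (l2 j) n.+1) -> changed l1 e t = changed l2 e t.
  move=> tn eE ll'; apply/changedP/changedP => // -[j je lt]; exists j => //;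
    have := ll' j; lia.
apply: eq_big_seq => -[e t] /obs_seqP[[/= eE _] tn]; congr (_ * _); rewrite /lr_sign.
congr (_%:R - _%:R); congr nat_of_bool; apply: ext => // j; rewrite /glue; case: ifPn => jS.
- by have := hS j jS; lia.
- by rewrite c'E (hN j jS); lia.
- by [].
- by rewrite c'E; lia.
Qed.

Lemma pr_config_good h c : (forall j, (1 <= c j)%N) ->
  (forall j, j \in S -> (n < h j)%N) -> (forall j, j \notin S -> h j = c j) ->
  (P (C h `&` B) <= (expR (- l) / prior rho (glue k c) * prior rho h)%:E *
                   P (C (glue k c) `&` B))%E.
Proof.
move=> c1 hS hN.
have h1 j : (1 <= h j)%N.
  by have [/hS|/hN ->] := boolP (j \in S); [exact: leq_ltn_trans|exact: c1].
have kc1 j : (1 <= glue k c j)%N by rewrite /glue; case: ifP.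
rewrite (change_of_measure h1 kc1 FB).
rewrite (_ : expR (- l) / _ * _ = prior rho h / prior rho (glue k c) * expR (- l)); last first.
  by rewrite mulrC mulrCA mulrC.
rewrite [X in (_ <= X * _)%E]EFinM -muleA.
apply: lee_wpmul2l; first by rewrite lee_fin divr_ge0 ?ltW ?prior_gt0.
have mCB : measurable (C (glue k c) `&` B) by exact: measurableI.
rewrite -integral_cst//; apply: ge0_le_integral => //.
- by move=> w _; rewrite lee_fin lik_ratio_ge0.
- by apply/measurable_EFinP/measurable_funTS; exact: measurable_lik_ratio.
- move=> w [_ [_ Gw]]; rewrite lee_fin lik_ratioE ler_expR.
  exact: good_lik_le.
Qed.

Let late c : set Omega :=
  [set w | forall j, (if j \in S then [set m | (n < m)%N] else [set c j]) (lam j w)].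

(** Each late configuration [h] costs [exp (- l)] times its prior relative to that of [c]. Summing
    these priors rebuilds the probability of [late c], which supplies [exp (- qS n)]. *)
Lemma pr_late_good c : (forall j, (1 <= c j)%N) -> (forall j, j \in S -> c j = k j) ->
  (P (late c `&` B) <= (expR (- l - qS * n%:R) / prior_in k)%:E * P (C c `&` B))%E.
Proof.
move=> c1 cS; pose I := {ffun 'I_d -> nat}.
have cE : glue k c = c by apply/funext => j; rewrite /glue; case: ifPn => // /cS ->.
pose ok (h : I) := (forall j, j \in S -> (n < h j)%N) /\ (forall j, j \notin S -> h j = c j).
pose U (h : I) := if `[< ok h >] then C h `&` B else set0.
pose V (h : I) := if `[< ok h >] then C h else set0.
have mU h : measurable (U h) by rewrite /U; case: asboolP => // _; exact: measurableI.
have mV h : measurable (V h) by rewrite /V; case: asboolP.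
have pin : prior_in c = prior_in k.
  by apply: eq_bigr => j /cS ->.
have lateE : late c = \bigcup_h V h.
  apply/seteqP; split => w.
    move=> lw; exists [ffun j => lam j w] => //; rewrite /V asboolT.
      by move=> j; rewrite ffunE.
    by split => j jS; rewrite ffunE; have := lw j; rewrite ?jS ?(negbTE jS).
  move=> [h _]; rewrite /V; case: asboolP => // -[hS hN] hw j; rewrite hw.
  by case: ifPn => [/hS|/hN].
have lateBE : late c `&` B = \bigcup_h U h.
  rewrite lateE setI_bigcupl; apply: eq_bigcupr => h _; rewrite /U /V.
  by case: ifP => _ //; rewrite set0I.
pose p := fine (P (C c `&` B)).
have pE : (P (C c `&` B) = p%:E)%E.
  by rewrite /p fineK// fin_num_measure//; exact: measurableI.
have p0 : 0 <= p by rewrite -lee_fin -pE.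
rewrite lateBE pE; apply: (@le_trans _ _ ((expR (- l) / prior rho c * p)%:E * P (\bigcup_h V h))%E).
  apply: measure_bigcup_le => //.
  - by rewrite mulr_ge0// divr_ge0 ?expR_ge0// ltW ?prior_gt0.
  - apply/trivIsetP => h h' _ _ /eqP hh'; apply/seteqP; split => // w; rewrite /V.
    do 2 case: asboolP => _; rewrite ?set0I ?setI0// => -[hw h'w].
    by apply: hh'; apply/ffunP => j; rewrite -hw -h'w.
  move=> h; rewrite /U /V; case: asboolP => [[hS hN]|_]; last by rewrite measure0 mule0.
  apply: (le_trans (pr_config_good c1 hS hN)).
  have h1 j : (1 <= h j)%N.
    by have [/hS|/hN ->] := boolP (j \in S); [exact: leq_ltn_trans|exact: c1].
  rewrite cE pE (pr_change_event lam_indep lam_geo h1) -!EFinM lee_fin.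
  by rewrite mulrAC.
rewrite -lateE pr_late_glue// -!EFinM lee_fin pin.
have := prior_gt0 rho01 c; have := prior_in_gt0 k; move: (prior rho c) (prior_in k) => x y y0 x0.
rewrite expRD mulrA le_eqVlt; apply/orP; left; apply/eqP.
by rewrite [qS * _]lock; field; rewrite !gt_eqF.
Qed.

(** Sum of [pr_late_good] over the configurations outside [S]. Each comparison partner agrees with
    [k] on [S], hence has changed by [n]; so the bound is one on the odds. *)
Lemma pr_no_change_good :
  (P (~` [set w | (phi w <= n)%N] `&` B) <=
   (expR (- l - qS * n%:R) / prior_in k)%:E * P ([set w | (phi w <= n)%N] `&` B))%E.
Proof.
pose I := {ffun 'I_d -> nat}.
pose ok (c : I) := (forall j, (1 <= c j)%N) /\ (forall j, j \in S -> c j = k j).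
pose U (c : I) := if `[< ok c >] then late c `&` B else set0.
pose V (c : I) := if `[< ok c >] then C c `&` B else set0.
have mlate (c : I) : measurable (late c) 
  by exact: (measurable_lam_rect lam (fun j => if j \in S then [set m | (n < m)%N] else [set c j])).
have mU c : measurable (U c) by rewrite /U; case: asboolP => // _; exact: measurableI.
have mV c : measurable (V c) by rewrite /V; case: asboolP => // _; exact: measurableI.
have r0 : 0 <= expR (- l - qS * n%:R) / prior_in k.
  by rewrite divr_ge0 ?expR_ge0// ltW ?prior_in_gt0.
have mphi := measurable_phi_le n.
apply: (@le_trans _ _ (P (\bigcup_c U c))).
  apply: le_measure; rewrite ?inE.
  - by apply: measurableI => //; exact: measurableC.
  - exact: (countable_bigcupT_measurable (countableP _)).
  move=> w [/negP]; rewrite -ltnNge => nphi Bw.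
  exists [ffun j => if j \in S then k j else lam j w] => //; rewrite /U asboolT.
    split => // j; rewrite /= ffunE; case: ifPn => jS; rewrite /= ?(negbTE jS)//.
    by apply: leq_trans nphi _; exact: (min_over_le (fun j => lam j w)).
  by split => j; rewrite ffunE; case: ifP.
apply: (@le_trans _ _ ((expR (- l - qS * n%:R) / prior_in k)%:E * P (\bigcup_c V c))%E).
  apply: measure_bigcup_le => //.
    apply/trivIsetP => h h' _ _ /eqP hh'; apply/seteqP; split => // w; rewrite /V.
    do 2 case: asboolP => _; rewrite ?set0I ?setI0// => -[[hw _] [h'w _]].
    by apply: hh'; apply/ffunP => j; rewrite -hw -h'w.
  move=> c; rewrite /U /V; case: asboolP => [[c1 cS]|_]; last by rewrite measure0 mule0.
  exact: pr_late_good.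
apply: lee_wpmul2l; first by rewrite lee_fin.
apply: le_measure; rewrite ?inE.
- exact: (countable_bigcupT_measurable (countableP _)).
- exact: measurableI.
move=> w [c _]; rewrite /V; case: asboolP => [[c1 cS]|//] [cw Bw]; split => //=.
rewrite (phi_change_event cw); have [j jS kj] := min_over_attained k S0.
by rewrite (leq_trans (min_over_le c jS))// cS// -kj.
Qed.

(* On [B] the odds of no change are less than [a], whereas [post n <= 1 - a]
   forces them to be at least [a]; hence [B] carries no mass. *)
Lemma pr_good_post_low : (1 <= n)%N -> (forall w, A w -> post n w <= 1 - a) ->
  expR (- l - qS * n%:R) / prior_in k < a -> P (C k `&` B) = 0%E.
Proof.
move=> n1 postA ra; have mphi := measurable_phi_le n.
have := pr_no_change_good; have := post_le_pr n1 FB (fun w Bw => postA w Bw.1).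
have : (P B = P ([set w | (phi w <= n)%N] `&` B) + P (~` [set w | (phi w <= n)%N] `&` B))%E.
  rewrite -measureU//; last 3 first.
  - exact: measurableI.
  - by apply: measurableI => //; exact: measurableC.
  - by apply/seteqP; split => // w [[? ?] []].
  by congr (P _); rewrite -setIUl setUv setTI.
have : (P B \is a fin_num)%E by exact: fin_num_measure.
have : (P ([set w | (phi w <= n)%N] `&` B) \is a fin_num)%E.
  by apply: fin_num_measure; exact: measurableI.
have : (P (~` [set w | (phi w <= n)%N] `&` B) \is a fin_num)%E.
  by apply: fin_num_measure; apply: measurableI => //; exact: measurableC.
have Ck : (P (C k `&` B) <= P ([set w | (phi w <= n)%N] `&` B))%E.
  apply: le_measure; rewrite ?inE; [exact: measurableI|exact: measurableI|].
  by move=> w [kw Bw]; split => //=; rewrite (phi_change_event kw).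
move: Ck; have : (0 <= P (~` [set w | (phi w <= n)%N] `&` B))%E by [].
have : (0 <= P ([set w | (phi w <= n)%N] `&` B))%E by [].
move: (P (~` _ `&` B)) (P ([set w | _] `&` B)) (P B) => [y| |] // [x| |] // [z| |] //.
rewrite -EFinD !lee_fin => x0 y0 Ck _ _ _ [->] ax yx.
have /andP[a0 a1] := a01.
(* The posterior bound gives [a x <= (1 - a) y <= y], while the odds bound would give [y < a x] if
   [x] were positive. *)
have {}x0 : x = 0.
  apply/eqP; rewrite eq_le x0 andbT leNgt; apply/negP => x_gt0.
  have : y < a * x by apply: le_lt_trans yx _; rewrite ltr_pM2r.
  have : 0 <= a * y by rewrite mulr_ge0// ltW.
  by lra.
by apply/eqP; rewrite eq_le measure_ge0 andbT; rewrite x0 in Ck.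
Qed.

End Late.

Lemma pr_bad_lik_one k c b n (th l : R) :
  (forall j, (1 <= k j <= b)%N) -> 0 <= th -> th * M <= 2^-1 ->
  (P (C k `&` [set w | (- l <= log_lik (glue (fun=> n.+1) c) (glue k c) n w)%R]) <=
   (prior rho k * expR (b%:R * (n_edges * (th * M) + th * I_info E mu g f S) +
      n%:R * (n_edges * (2 * th ^+ 2 * M ^+ 2) - th * I_info E mu g f S) + th * l))%:E)%E.
Proof.
move=> k1b th0 thM; set h := glue _ c; set h' := glue k c.
have k1 j : (1 <= k j)%N by have /andP[] := k1b j.
have kb j : (k j <= b)%N by have /andP[] := k1b j.
set z := 2 * th ^+ 2 * M ^+ 2.
have z0 : 0 <= z by rewrite /z mulr_ge0 ?sqr_ge0// mulr_ge0 ?sqr_ge0.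
(* The main exponent is charged at all [n] times; the correction before [b] cancels its drift and
   leaves the crude bound [th * M], plus [z]. *)
pose be e t : R := (if (t < b)%N then th * M + th * kl_in e else 0) + (z - th * kl_in e).
apply: (le_trans (@chernoff k h h' n th (- l) (fun i => be i.1 i.2) k1 th0 _)).
  move=> [e t] /obs_seqP[[/= eE t1] tn]; rewrite /be/=; case: ltnP => tb.
    apply: (le_trans (mgf_le_sup k t eE (lr_sign_norm _ _ _ _) th0)).
    by rewrite lee_fin ler_expR; lra.
  have ke : changed k e t.
    apply/changedP => //; have /set0Pn[j je] := extended_edge_neq0 eE.
    by exists j => //; exact: leq_trans tb.
  have thN : `|- th| * M <= 2^-1 by rewrite normrN ger0_norm.
  rewrite add0r /kl_in; have [eS|eS] := boolP (e \subset S).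
    have -> : lr_sign h h' e t = -1.
      rewrite /lr_sign; have -> : changed h e t = false.
        apply/negP => /changedP-/(_ eE)[j je]; have jS := fintype.subsetP eS j je.
        by rewrite /h /glue jS ltnNge tn.
      have -> : changed h' e t.
        apply/changedP => //; have /set0Pn[j je] := extended_edge_neq0 eE.
        exists j => //; rewrite /h' /glue (fintype.subsetP eS j je).
        exact: leq_trans tb.
      by rewrite sub0r.
    under eq_integral do rewrite mulrN1.
    apply: (le_trans (mgf_changed eE ke thN)).
    by rewrite lee_fin ler_expR /z sqrrN mulNr addrC.
  rewrite mulr0 subr0 /lr_sign; have [ht|ht] := boolP (changed h e t).
    have -> : changed h' e t.
      move/changedP : ht => /(_ eE)[j je ht]; apply/changedP => //; exists j => //.
      by move: ht; rewrite /h /h' /glue; case: ifP => // _; rewrite ltnNge tn.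
    by rewrite subrr mulr0 mgf_unsigned// lee_fin -[leLHS]expR0 ler_expR.
  (* As [c] is arbitrary, an edge leaving [S] may stay unchanged under [h] up to [n]. Its sign is
     then -1 and its drift helps, since [kl_info] is nonnegative. *)
  case: (changed h' e t).
    rewrite sub0r; under eq_integral do rewrite mulrN1.
    apply: (le_trans (mgf_changed eE ke thN)).
    have [dg df] := dens eE.
    rewrite lee_fin ler_expR -/z sqrrN -/z mulNr gerDr oppr_le0 mulr_ge0//.
    exact: (kl_info_ge0 df dg (supM eE)).
  by rewrite subr0 mulr0 mgf_unsigned// lee_fin -[leLHS]expR0 ler_expR.
rewrite lee_fin ler_wpM2l//; first exact/ltW/prior_gt0.
rewrite ler_expR mulrN opprK lerD2r sum_obs_seq.
have -> : b%:R * (n_edges * (th * M) + th * I_info E mu g f S) +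
    n%:R * (n_edges * z - th * I_info E mu g f S) =
    \sum_(e in extended_edges E)
      (b%:R * (th * M + th * kl_in e) + n%:R * (z - th * kl_in e)).
  rewrite I_infoE big_split/= -!mulr_sumr !big_split/= sumrN !sum_edges_const -!mulr_sumr.
  by rewrite mulr_sumr.
apply: ler_sum => e eE; have kl0 := kl_in_ge0 eE.
rewrite big_split/= sum_iota_step mul0rn addr0 big_const_seq count_predT size_iota.
rewrite iter_addr addr0 lerD//; last by rewrite mulr_natl.
rewrite mulr_natl; apply: ler_wpMn2l; last exact: (leq_trans (geq_minr _ _) (leq_pred _)).
by rewrite addr_ge0// mulr_ge0.
Qed.

Lemma pr_bad_lik k b n (th l : R) :
  (forall j, (1 <= k j <= b)%N) -> 0 <= th -> th * M <= 2^-1 ->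
  (P (C k `&` ~` good_lik k n l) <=
   (prior rho k * ((n.+1 ^ d)%:R *
    expR (b%:R * (n_edges * (th * M) + th * I_info E mu g f S) +
      n%:R * (n_edges * (2 * th ^+ 2 * M ^+ 2) - th * I_info E mu g f S) + th * l)))%:E)%E.
Proof.
move=> k1b th0 thM; set r := expR _.
pose W (c : {ffun 'I_d -> 'I_n.+1}) := C k `&`
  [set w | (- l <= log_lik (glue (fun=> n.+1) (frozen c)) (glue k (frozen c)) n w)%R].
have mW c : measurable (W c).
  apply: measurableI => //; rewrite -[X in measurable X]setTI.
  exact: (measurable_fun_le measurableT (measurable_cst _) (measurable_log_lik _ _ _)).
have mG := measurable_obs_filtration (@obs_filtration_good_lik k n l).
have GW : C k `&` ~` good_lik k n l `<=` \bigcup_c W c.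
  move=> w [kw nG]; apply: contrapT => H; apply: nG => c _ /=.
  by rewrite leNgt; apply/negP => h; apply: H; exists c => //; split => //=; exact: ltW.
apply: (le_trans (measure_finbigcup_le P mW _ GW)).
  by apply: measurableI => //; exact: measurableC.
apply: (@le_trans _ _ (\sum_(c : {ffun 'I_d -> 'I_n.+1}) (prior rho k * r)%:E)%E).
  by apply: lee_sum => c _; exact: pr_bad_lik_one.
rewrite sumEFin sumr_const card_ffun !card_ord lee_fin -[leLHS]mulr_natl.
by rewrite mulrCA.
Qed.

Definition prior_floor : R := \prod_(j in S) rho j.

Lemma prior_floor_gt0 : 0 < prior_floor.
Proof. by apply: prodr_gt0 => j _; have /andP[] := rho01 j. Qed.

(** [prior_floor] is [prior_in] with all changes at time 1; postponing them up to [b] costs at most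
    the exponential. This makes the odds bound uniform over [k]. *)
Lemma prior_in_ge k b : (forall j, (k j <= b)%N) ->
  expR (- (qS * b%:R)) * prior_floor <= prior_in k.
Proof.
move=> kb; rewrite expR_q_info -big_split/=; apply: ler_prod => j _.
have /andP[r0 r1] := rho01 j; have r1' : 0 <= 1 - rho j by rewrite subr_ge0 ltW.
rewrite mulr_ge0 ?exprn_ge0// ?(ltW r0)//= ler_pM2r// ler_wiXn2l//.
  by rewrite gerBl ltW.
by have := kb j; lia.
Qed.

Lemma q_info_gt0 : 0 < qS.
Proof.
have /set0Pn[j jS] := S0.
have ln0 i : 0 < - ln (1 - rho i).
  have /andP[r0 r1] := rho01 i.
  by rewrite oppr_gt0 ln_lt0// subr_gt0 r1 gtrBl.
rewrite /qS /q_info -sumrN (bigD1 j)//=; apply: ltr_wpDr => //.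
by apply: sumr_ge0 => i _; exact/ltW.
Qed.

(** The condition on [a] pushes the odds bound below [a] for every configuration bounded by [b].
    Late stopping then has probability zero on [good_lik], and only its complement and large change
    points remain. *)
Lemma threshold_late b m (th l : R) :
  0 <= th -> th * M <= 2^-1 ->
  expR (- l - qS * m%:R + qS * b%:R) < a * prior_floor ->
  (P [set w | ((phi w + m)%:R%:E < tau w)%E] <=
   (\sum_j (1 - rho j) ^+ b +
    ((b + m).+1 ^ d)%:R *
    expR (b%:R * (n_edges * (th * M) + th * I_info E mu g f S) +
      (b + m)%:R * (n_edges * (2 * th ^+ 2 * M ^+ 2)) -
      m%:R * (th * I_info E mu g f S) + th * l))%:E)%E.
Proof.
move=> th0 thM la; set r := _ * expR _.
pose I := {ffun 'I_d -> nat}; pose ok (k : I) := forall j, (1 <= k j <= b)%N.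
pose n (k : I) := (min_over k S + m)%N.
pose A (k : I) := ~` [set w | (tau w <= (n k)%:R%:E)%E].
have FA (k : I) : obs_filtration E X (n k) (A k).
  by apply: obs_filtrationC; have [_] := tau_threshold_stop; exact.
have mA (k : I) : measurable (A k) by exact: (measurable_obs_filtration (FA k)).
pose U (k : I) := if `[< ok k >] then C k `&` A k else set0.
have mU (k : I) : measurable (U k).
  by rewrite /U; case: asboolP => // _; exact: measurableI.
pose B0 j := [set w | (b < lam j w)%N].
have mB0 j : measurable (B0 j) by exact: (measurable_lam_set lam j [set i | (b < i)%N]).
have r0 : 0 <= r by rewrite mulr_ge0 ?expR_ge0.
have UE : (P (\bigcup_(k : I) U k) <= r%:E)%E.
  rewrite -[leRHS]mule1; apply: (@le_trans _ _ (r%:E * P (\bigcup_(k : I) C k))%E); last first.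
    apply: lee_wpmul2l; first by rewrite lee_fin.
    apply: probability_le1.
    by apply: (countable_bigcupT_measurable (countableP _)) => k.
  apply: measure_bigcup_le => //.
  - apply/trivIsetP => k k' _ _ /eqP kk'; apply/seteqP; split => // w [kw k'w].
    by apply: kk'; apply/ffunP => j; rewrite -kw -k'w.
  move=> k; rewrite /U; case: asboolP => [okk|_]; last first.
    by rewrite measure0 mule_ge0// lee_fin.
  have k1 j : (1 <= k j)%N by have /andP[] := okk j.
  have kb j : (k j <= b)%N by have /andP[] := okk j.
  have [j0 j0S kj0] := min_over_attained k S0.
  have nb : (m <= n k <= b + m)%N.
    by rewrite /n leq_addl/= leq_add2r kj0.
  have n1 : (1 <= n k)%N by rewrite /n kj0 ltn_addr.
  have z0 : 0 <= 2 * th ^+ 2 * M ^+ 2 by rewrite mulr_ge0 ?sqr_ge0// mulr_ge0 ?sqr_ge0.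
  pose G := good_lik k (n k) l.
  have mG := measurable_obs_filtration (@obs_filtration_good_lik k (n k) l).
  apply: (@le_trans _ _ (P (C k `&` (A k `&` G)) + P (C k `&` ~` G))%E).
    rewrite -[C k `&` A k]setIT -(setUv G) setIUr -setIA.
    apply: (le_trans (measureU2 _ _ _)).
    - by apply: measurableI => //; exact: measurableI.
    - by apply: measurableI; [exact: measurableI|exact: measurableC].
    apply: leeD => //; apply: le_measure; rewrite ?inE.
    - by apply: measurableI; [exact: measurableI|exact: measurableC].
    - by apply: measurableI => //; exact: measurableC.
    by move=> w [[]].
  rewrite pr_good_post_low//; last 3 first.
  - by rewrite leq_addr.
  - move=> w /negP; rewrite -ltNge => tw; rewrite leNgt; apply/negP => h.
    move: tw; apply/negP; rewrite -leNgt; apply/tau_threshold_leP.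
    by exists (n k); [rewrite n1 leqnn|exact: ltW].
  - rewrite ltr_pdivrMr ?prior_in_gt0//.
    apply: (@lt_le_trans _ _ (a * (expR (- (qS * b%:R)) * prior_floor))); last first.
      by have /andP[a0 _] := a01; rewrite ler_pM2l// prior_in_ge.
    rewrite mulrCA expRN -ltr_pdivrMl ?invr_gt0 ?expR_gt0// invrK -expRD.
    apply: le_lt_trans la; rewrite ler_expR.
    have : qS * m%:R <= qS * (n k)%:R.
      by rewrite ler_wpM2l ?ler_nat ?ltW ?q_info_gt0//; have /andP[] := nb.
    by lra.
  rewrite add0e; apply: (le_trans (pr_bad_lik (n k) l okk th0 thM)).
  rewrite (pr_change_event lam_indep lam_geo k1) -EFinM lee_fin mulrC.
  rewrite ler_wpM2r//; first exact/ltW/prior_gt0.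
  have /andP[nm nbm] := nb.
  apply: ler_pM; rewrite ?expR_ge0//.
    by rewrite !natrX lerXn2r ?nnegrE// ler_nat ltnS.
  (* [n k] lies between [m] and [b + m]: the fluctuation term takes the upper end, the drift the
     lower one. *)
  rewrite ler_expR lerD2r -addrA lerD2l mulrBr lerB// ler_wpM2r ?ler_nat//.
    by rewrite mulr_ge0.
  by rewrite mulr_ge0// I_info_ge0.
pose W (i : 'I_d + unit) := match i with inl j => B0 j | inr _ => \bigcup_(k : I) U k end.
have mW i : measurable (W i).
  by case: i => [j|[]] //=; exact: (countable_bigcupT_measurable (countableP _)).
have DW : [set w | ((phi w + m)%:R%:E < tau w)%E] `<=` \bigcup_i W i.
  move=> w /= late.
  have [[j bj]|small] := pselect (exists j, (b < lam j w)%N); first by exists (inl j).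
  pose k : I := [ffun j => lam j w].
  have kw : C k w by move=> j; rewrite ffunE.
  have okk : ok k.
    move=> j; rewrite ffunE lam1/= leqNgt; apply/negP => bj; apply: small.
    by exists j.
  exists (inr tt) => //; exists k => //; rewrite /U asboolT//; split => //.
  by apply/negP; rewrite -ltNge /n -(phi_change_event kw).
have mD : measurable [set w | ((phi w + m)%:R%:E < tau w)%E].
  rewrite (_ : [set _ | _] = ~` [set w | (tau w <= (phi w + m)%:R%:E)%E]).
    by apply: measurableC; exact: measurable_stop_le_phi tau_threshold_stop _.
  by apply/seteqP; split => w /=; rewrite ltNge => /negP.
apply: (le_trans (measure_finbigcup_le P mW mD DW)).
rewrite big_sumType/= (big_pred1 tt)/= ?EFinD; last by case.
apply: leeD => //.
by rewrite -sumEFin; apply: lee_sum => j _; rewrite (pr_lam_gt lam1 lam_geo).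
Qed.

End Threshold.

(** * Expected delay *)

Section Delay.
Variable tau : Omega -> \bar R.
Hypothesis tau_stop : is_stopping_time (obs_filtration E X) tau.

Let late n := [set w | ((phi w + n)%:R%:E < tau w)%E].

Lemma measurable_late n : measurable (late n).
Proof.
rewrite (_ : late n = ~` [set w | (tau w <= (phi w + n)%:R%:E)%E]).
  by apply: measurableC; exact: measurable_stop_le_phi.
by apply/seteqP; split => w; rewrite /late/= ltNge => /negP.
Qed.

(** Tail-sum formula, pointwise, so that an infinite [tau] gives a divergent series. *)
Lemma delay_series w : ((phi w)%:R%:E <= tau w)%E ->
  (tau w - (phi w)%:R%:E = \sum_(n <oo) (\1_(late n) w)%:E)%E.
Proof.
move=> phi_le; have ind0 n : (0 <= (\1_(late n) w : R)%:E)%E by rewrite lee_fin.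
have indE n : (w \in late n) = ((phi w + n)%:R%:E < tau w)%E.
  by apply/idP/idP; rewrite inE.
have [tw|[N tw]] := stopping_cases tau_stop w.
  rewrite tw addye//; apply/esym/eqyP => x x0.
  apply: (@le_trans _ _ (\sum_(0 <= n < (Num.truncn x).+1) (\1_(late n) w)%:E)%E); last first.
    by apply: nneseries_lim_ge => n _ _; exact: ind0.
  rewrite (eq_bigr (fun=> 1%E)); last by move=> n _; rewrite indicE indE tw ltry.
  rewrite sumEFin big_const_nat subn0 iter_addr addr0 lee_fin.
  by rewrite ltW// truncnS_gt.
rewrite tw lee_fin ler_nat in phi_le.
rewrite tw -EFinB -natrB// (nneseries_split 0 (N - phi w)); last by move=> n _; exact: ind0.
rewrite add0n [X in (_ + X)%E]eseries0 ?adde0; last first.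
  move=> n nN _; rewrite indicE indE tw lte_fin ltr_nat.
  by rewrite (_ : (_ < _)%N = false)//; apply/negbTE; rewrite -leqNgt; lia.
rewrite (eq_big_nat _ _ (F2 := fun=> 1%E)); last first.
  move=> n /andP[_ nN]; rewrite indicE indE tw lte_fin ltr_nat.
  by rewrite (_ : (_ < _)%N = true)//; lia.
by rewrite sumEFin big_const_nat subn0 iter_addr addr0.
Qed.

Lemma delay_tail_sum :
  (detection_delay P phi tau =
   (\sum_(n <oo) P (late n)) / P [set w | ((phi w)%:R%:E <= tau w)%E])%E.
Proof.
have mD : measurable [set w | ((phi w)%:R%:E <= tau w)%E].
  rewrite (_ : [set _ | _] = ~` [set w | (tau w < (phi w)%:R%:E)%E]).
    by apply: measurableC; exact: measurable_stop_lt_phi.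
  by apply/seteqP; split => w /=; rewrite leNgt => /negP.
rewrite /detection_delay /cond_expect; congr (_ / _)%E.
under eq_integral => w wD do rewrite (delay_series (set_mem wD)).
rewrite integral_nneseries//; last first.
  move=> n; apply/measurable_EFinP; apply: measurable_funTS.
  by apply: measurable_indic; exact: measurable_late.
apply: eq_eseriesr => n _; rewrite integral_indic//; last exact: measurable_late.
congr (P _); apply/setIidl => w; rewrite /late/= => h.
by apply/ltW; apply: le_lt_trans h; rewrite lee_fin ler_nat leq_addr.
Qed.

Variable a : R.
Hypotheses (a01 : 0 < a < 1) (tau_a : (P [set w | (tau w < (phi w)%:R%:E)%E] <= a%:E)%E).

Let D := [set w | ((phi w)%:R%:E <= tau w)%E].

Lemma pr_no_false_alarm : exists2 p : R, (P D = p%:E)%E & 1 - a <= p <= 1.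
Proof.
have mD : measurable [set w | (tau w < (phi w)%:R%:E)%E] by exact: measurable_stop_lt_phi.
have DE : D = ~` [set w | (tau w < (phi w)%:R%:E)%E].
  by apply/seteqP; split => w; rewrite /D/= leNgt => /negP.
have : (P [set w | (tau w < (phi w)%:R%:E)%E] \is a fin_num)%E by exact: fin_num_measure.
move: tau_a; rewrite DE probability_setC//.
have : (0 <= P [set w | (tau w < (phi w)%:R%:E)%E])%E by [].
case: (P [set w | _]) => // y; rewrite !lee_fin => y0 ya _.
by exists (1 - y); [rewrite EFinB|lra].
Qed.

(** No false alarm has probability at least [1 - a], so each of the first [m] tail terms is at least
    [1 - a - r]; conditioning divides by a number at most 1. *)
Lemma delay_ge m (r : R) :
  (P [set w | ((phi w)%:R%:E <= tau w <= (phi w + m)%:R%:E)%E] <= r%:E)%E ->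
  0 <= 1 - a - r ->
  ((m%:R * (1 - a - r))%:E <= detection_delay P phi tau)%E.
Proof.
move=> early r1; have [p pE /andP[ap p1]] := pr_no_false_alarm.
have /andP[a0 a1] := a01.
have p0 : 0 < p by lra.
rewrite delay_tail_sum -/D pE inver gt_eqF//.
have Lm n : (n <= m)%N -> ((1 - a - r)%:E <= P (late n))%E.
  move=> nm; apply: (@le_trans _ _ (P (late m))); last first.
    apply: le_measure; rewrite ?inE; [exact: measurable_late|exact: measurable_late|].
    by move=> w; rewrite /late/=; apply: le_lt_trans; rewrite lee_fin ler_nat leq_add2l.
  have mD : measurable D.
    rewrite (_ : D = ~` [set w | (tau w < (phi w)%:R%:E)%E]).
      by apply: measurableC; exact: measurable_stop_lt_phi.
    by apply/seteqP; split => w; rewrite /D/= leNgt => /negP.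
  have : (P D <= P [set w | ((phi w)%:R%:E <= tau w <= (phi w + m)%:R%:E)%E] + P (late m))%E.
    have mL := measurable_late m.
    have mDm : measurable [set w | ((phi w)%:R%:E <= tau w <= (phi w + m)%:R%:E)%E].
      rewrite (_ : [set _ | _] = D `&` [set w | (tau w <= (phi w + m)%:R%:E)%E]).
        by apply: measurableI => //; exact: measurable_stop_le_phi.
      by apply/seteqP; split => w; rewrite /D/=; [move=> /andP[]|move=> [-> ->]].
    apply: le_trans (measureU2 P mDm mL).
    apply: le_measure; rewrite ?inE//; first exact: measurableU.
    move=> w; rewrite /D /late /= => ->/=.
    by have [h|h] := leP (tau w) ((phi w + m)%:R%:E); [left|right].
  rewrite pE => h; have : (P (late m) \is a fin_num)%E.
    by apply: fin_num_measure; exact: measurable_late.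
  case: (P (late m)) h => // y h _; rewrite lee_fin.
  have : (p%:E <= (r + y)%:E)%E by rewrite EFinD (le_trans h)// leeD2r.
  by rewrite lee_fin; lra.
apply: (@le_trans _ _ (\sum_(n <oo) P (late n))%E); last first.
  rewrite -[leLHS]mule1; apply: lee_wpmul2l; first exact: nneseries_ge0.
  by rewrite lee_fin invf_ge1.
apply: (@le_trans _ _ (\sum_(0 <= n < m) P (late n))%E); last first.
  by apply: nneseries_lim_ge => n _ _.
apply: (@le_trans _ _ (\sum_(0 <= n < m) (1 - a - r)%:E)%E).
  by rewrite sumEFin big_const_nat subn0 iter_addr addr0 lee_fin mulr_natl.
by rewrite big_nat [leRHS]big_nat; apply: lee_sum => n /andP[_ nm]; apply: Lm; exact: ltnW.
Qed.

(** The first [m] tail terms are at most 1, the others are dominated by a geometric series, and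
    conditioning divides by at least [1 - a]. *)
Lemma delay_le m (c k : R) : 0 <= c -> 0 < k ->
  (forall n, (m <= n)%N -> (P (late n) <= (c * expR (- (k * n%:R)))%:E)%E) ->
  (detection_delay P phi tau <= ((m%:R + c / (1 - expR (- k))) / (1 - a))%:E)%E.
Proof.
move=> c0 k0 bnd; have [p pE /andP[ap p1]] := pr_no_false_alarm.
have /andP[a0 a1] := a01.
have p0 : 0 < p by lra.
have r1 : 0 < 1 - expR (- k) by rewrite subr_gt0 expR_lt1 oppr_lt0.
rewrite delay_tail_sum -/D pE inver gt_eqF//.
have K0 : 0 <= m%:R + c / (1 - expR (- k)) by rewrite addr_ge0// divr_ge0// ltW.
apply: (@le_trans _ _ ((m%:R + c / (1 - expR (- k)))%:E * (p^-1)%:E)%E); last first.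
  rewrite -EFinM lee_fin ler_wpM2l// lef_pV2 ?posrE//; lra.
apply: lee_wpmul2r; first by rewrite lee_fin invr_ge0 ltW.
rewrite (nneseries_split 0 m) ?add0n; last by [].
rewrite EFinD; apply: leeD.
  apply: (@le_trans _ _ (\sum_(0 <= n < m) 1%E)).
    by rewrite big_nat [leRHS]big_nat; apply: lee_sum => n _; apply: probability_le1; exact: measurable_late.
  by rewrite sumEFin big_const_nat subn0 iter_addr addr0.
apply: lime_le; first exact: is_cvg_nneseries.
apply: nearW => N.
apply: (@le_trans _ _ (\sum_(m <= n < N) (c * expR (- (k * n%:R)))%:E)%E).
  by rewrite big_nat [leRHS]big_nat; apply: lee_sum => n /andP[mn _]; exact: bnd.
rewrite sumEFin lee_fin.
apply: (@le_trans _ _ (\sum_(0 <= n < N) c * expR (- k) ^+ n)).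
  rewrite (eq_bigr (fun n => c * expR (- k) ^+ n)); last first.
    by move=> n _; rewrite -expRM_natl mulrN [k * _]mulrC.
  have [Nm|mN] := leqP N m.
    by rewrite big_geq// sumr_ge0// => n _; rewrite mulr_ge0// exprn_ge0// expR_ge0.
  rewrite [leRHS](@big_cat_nat _ _ _ m)//=; last exact: ltnW.
  by rewrite lerDr sumr_ge0// => n _; rewrite mulr_ge0// exprn_ge0// expR_ge0.
have r01 : `|expR (- k)| < 1 by rewrite ger0_norm ?expR_ge0// expR_lt1 oppr_lt0.
exact: (geometric_le_lim N c0 (expR_gt0 (- k)) r01).
Qed.

End Delay.

(** * Choice of the parameters and exponential decay *)

Let IS := I_info E mu g f S.

Let n_edges_ge0 : 0 <= n_edges. Proof. exact: ler0n. Qed.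

(** [th] is so small that the quadratic term takes a quarter of the slack [th * eps] per step. [L]
    is so large that the cost of the first [m / L] times takes another quarter. *)
Lemma chernoff_params (eps : R) : 0 < eps -> exists (th : R) (L : nat),
  [/\ 0 < th, th * M <= 2^-1, (0 < L)%N &
      [/\ n_edges * (2 * th ^+ 2 * M ^+ 2) <= th * eps / 4,
          n_edges * (th * M) + th * IS + th * eps / 4 <= L%:R * (th * eps / 4) &
          qS <= L%:R * eps]].
Proof.
move=> e0; have I0 : 0 <= IS := I_info_ge0; have Mpos : 0 < M := lt_le_trans ltr01 M1.
(* With [th = eps / D], the first summand of [D] yields the quadratic condition and the second
   [th * M <= 2^-1]. *)
pose D := 8 * (n_edges + 1) * M ^+ 2 + 2 * M * eps.
have Npos : 0 < n_edges + 1 by rewrite ltr_wpDl.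
have B0 : 0 < 8 * (n_edges + 1) * M ^+ 2 by rewrite mulr_gt0 ?exprn_gt0// mulr_gt0.
have B1 : 0 < 2 * M * eps by rewrite !mulr_gt0.
have D0 : 0 < D by exact: addr_gt0.
pose th := eps / D; have th0 : 0 < th by rewrite divr_gt0.
have thD : th * D = eps by rewrite /th mulfVK// gt_eqF.
pose y := (n_edges * (th * M) + th * IS + th * eps / 4) / (th * eps / 4) + qS / eps.
have te0 : 0 < th * eps / 4 by rewrite divr_gt0// mulr_gt0.
have y1 : 0 <= (n_edges * (th * M) + th * IS + th * eps / 4) / (th * eps / 4).
  apply: divr_ge0; last exact: ltW.
  apply: addr_ge0; last exact: ltW.
  apply: addr_ge0; last by rewrite mulr_ge0// ltW.
  by rewrite mulr_ge0// mulr_ge0// ltW.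
have y2 : 0 <= qS / eps by rewrite divr_ge0 ?(ltW e0)// ltW// q_info_gt0.
have yL : y <= (Num.truncn y).+1%:R by rewrite ltW// truncnS_gt.
exists th, (Num.truncn y).+1; split => //.
  have h : th * (2 * M * eps) <= eps by rewrite -[leRHS]thD ler_pM2l// /D lerDr ltW.
  by rewrite -(ler_pM2r e0); lra.
split.
- have h1 : 8 * (n_edges + 1) * M ^+ 2 * th <= eps.
    by rewrite mulrC -[leRHS]thD ler_pM2l// /D lerDl ltW.
  have h2 : 0 <= th * (M ^+ 2 * th) by rewrite mulr_ge0 ?(ltW th0)// mulr_ge0 ?(ltW th0)// sqr_ge0.
  have h3 : th * (8 * (n_edges + 1) * M ^+ 2 * th) <= th * eps by rewrite ler_pM2l.
  have -> : n_edges * (2 * th ^+ 2 * M ^+ 2) = 2 * (n_edges * (th * (M ^+ 2 * th))) by ring.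
  have : th * (8 * (n_edges + 1) * M ^+ 2 * th) = 8 * (n_edges * (th * (M ^+ 2 * th))) + 8 * (th * (M ^+ 2 * th)) by ring.
  by lra.
- by rewrite -ler_pdivrMr// (le_trans _ yL)// /y lerDl.
- by rewrite -ler_pdivrMr// (le_trans _ yL)// /y lerDr.
Qed.

Lemma pos_lower_bound (I : finType) (F : I -> R) :
  (forall i, 0 < F i) -> exists2 k, 0 < k & forall i, k <= F i.
Proof.
move=> F0; have s0 : 0 <= \sum_i (F i)^-1 by apply: sumr_ge0 => i _; rewrite invr_ge0 ltW.
have s1 : 0 < 1 + \sum_i (F i)^-1 by rewrite ltr_pwDl.
exists (1 + \sum_i (F i)^-1)^-1; first by rewrite invr_gt0.
move=> i; rewrite invf_ple ?posrE// (bigD1 i)//= addrCA lerDl addr_ge0//.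
by apply: sumr_ge0 => j _; rewrite invr_ge0 ltW.
Qed.

(** [m %/ L] exceeds [m / L - 1]; the constants [expR (s j)] pay for the lost unit. *)
Lemma geometric_tail_decay L : (0 < L)%N -> exists C k : R, [/\ 0 <= C, 0 < k &
  forall m, \sum_j (1 - rho j) ^+ (m %/ L) <= C * expR (- (k * m%:R))].
Proof.
move=> L0; pose s j := - ln (1 - rho j).
have r1 j : 0 < 1 - rho j by have /andP[_ ?] := rho01 j; rewrite subr_gt0.
have s0 j : 0 < s j.
  have /andP[r0 _] := rho01 j.
  by rewrite /s oppr_gt0 ln_lt0// r1 gtrBl.
have L0' : 0 < L%:R :> R by rewrite ltr0n.
have [k k0 ks] := pos_lower_bound (fun j => divr_gt0 (s0 j) L0').
exists (\sum_j expR (s j)), k; split => //.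
  by apply: sumr_ge0 => j _; exact: expR_ge0.
move=> m; rewrite mulr_suml; apply: ler_sum => j _.
rewrite -[X in X ^+ _]lnK ?posrE// -expRM_natl -expRD ler_expR.
rewrite -[ln _]opprK -/(s j) mulrN.
have h1 : m%:R <= ((m %/ L)%:R + 1) * L%:R :> R.
  by rewrite natr1 -natrM ler_nat ltnW// ltn_ceil.
have h2 : k * L%:R <= s j by rewrite -ler_pdivlMr.
have h3 : k * m%:R <= k * (((m %/ L)%:R + 1) * L%:R) by rewrite ler_pM2l.
have h4 : k * L%:R * ((m %/ L)%:R + 1) <= s j * ((m %/ L)%:R + 1).
  by rewrite ler_wpM2r// addr_ge0.
lra.
Qed.

(** With [x = k m / (e + 1)], [c] is chosen so that [1 + 2 m <= c (1 + x) <= c exp x]; the e-th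
    power has exponent at most [k m]. Dividing by [e + 1] covers [e = 0]. *)
Lemma poly_le_expR (e : nat) (k : R) : 0 < k -> exists2 C : R, 0 <= C &
  forall m, ((m + m).+1 ^ e)%:R <= C * expR (k * m%:R).
Proof.
move=> k0; pose c := 1 + 2 * (e.+1%:R / k).
have ek0 : 0 < e.+1%:R / k by rewrite divr_gt0.
have c0 : 0 <= c by rewrite /c addr_ge0// mulr_ge0// ltW.
exists (c ^+ e); first by rewrite exprn_ge0.
move=> m; rewrite natrX.
have km0 : 0 <= k * m%:R / e.+1%:R by rewrite divr_ge0// mulr_ge0// ltW.
apply: (@le_trans _ _ ((c * expR (k * m%:R / e.+1%:R)) ^+ e)).
  rewrite lerXn2r ?nnegrE// ?mulr_ge0 ?expR_ge0//.
  apply: (@le_trans _ _ (c * (1 + k * m%:R / e.+1%:R))); last first.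
    by rewrite ler_wpM2l// expR_ge1Dx.
  have -> : (m + m).+1%:R = 1 + 2 * m%:R :> R by rewrite -natr1 natrD; lra.
  have -> : c * (1 + k * m%:R / e.+1%:R) =
     1 + 2 * m%:R + (k * m%:R / e.+1%:R + 2 * (e.+1%:R / k)).
    rewrite /c; field; rewrite gt_eqF//=; by rewrite addrC natr1 pnatr_eq0.
  by rewrite lerDl addr_ge0// mulr_ge0// ltW.
rewrite exprMn ler_wpM2l ?exprn_ge0// -expRM_natl ler_expR.
rewrite [leRHS](_ : _ = e.+1%:R * (k * m%:R / e.+1%:R)).
  by rewrite ler_wpM2r// ler_nat.
by field; rewrite addrC natr1 pnatr_eq0.
Qed.

Lemma expR_decay_add (c1 c2 k1 k2 : R) (x : R) : 0 <= x -> 0 <= c1 -> 0 <= c2 ->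
  c1 * expR (- (k1 * x)) + c2 * expR (- (k2 * x)) <=
  (c1 + c2) * expR (- (Num.min k1 k2 * x)).
Proof.
move=> x0 c10 c20; rewrite mulrDl lerD// ler_wpM2l// ler_expR lerN2 ler_wpM2r//.
  by rewrite ge_min lexx.
by rewrite ge_min lexx orbT.
Qed.

Let late tau n := [set w | ((phi w + n)%:R%:E < (tau w : \bar R))%E].

(** The constants are chosen before [a], because the tail series is summed from an index that grows
    as [a] tends to 0. *)
Lemma threshold_late_decay (eps : R) : 0 < eps -> exists C k c : R, [/\ 0 <= C, 0 < k &
  forall a m, 0 < a < 1 -> - ln a + c < (qS + IS - eps) * m%:R ->
  (P (late (tau_threshold post a) m) <= (C * expR (- (k * m%:R)))%:E)%E].
Proof.
move=> e0; have e20 : 0 < eps / 2 by rewrite divr_gt0.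
have [th [L [th0 thM L0 [hN hL hq]]]] := chernoff_params e20.
have [C1 [k1 [C10 k10 tail]]] := geometric_tail_decay L0.
set k2 := th * (eps / 2) / 4 in hN hL.
have k20 : 0 < k2 by rewrite divr_gt0// mulr_gt0.
have [C2 C20 poly] := poly_le_expR d k20.
exists (C1 + C2), (Num.min k1 k2), (- ln prior_floor); split.
- exact: addr_ge0.
- by rewrite lt_min k10.
move=> a m a01 am; pose b := (m %/ L)%N.
have /andP[a0 a1] := a01.
have bL : b%:R * L%:R <= m%:R :> R by rewrite -natrM ler_nat leq_trunc_div.
have bm : (b <= m)%N by exact: leq_div.
(* One half of [eps] is slack below the drift; the other pays for [qS * b] in the prior. *)
pose l := (IS - eps / 2) * m%:R.
have cond : expR (- l - qS * m%:R + qS * b%:R) < a * prior_floor.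
  have -> : a * prior_floor = expR (ln a + ln prior_floor).
    by rewrite expRD !lnK// posrE// prior_floor_gt0.
  rewrite ltr_expR.
  have : qS * b%:R <= eps / 2 * m%:R.
    apply: (@le_trans _ _ (L%:R * (eps / 2) * b%:R)); first by rewrite ler_wpM2r.
    rewrite (_ : _ * b%:R = eps / 2 * (b%:R * L%:R)); last by ring.
    by rewrite ler_wpM2l// ltW.
  rewrite /l; lra.
apply: (le_trans (@threshold_late a a01 b m th l (ltW th0) _ cond)) => //.
rewrite lee_fin; apply: le_trans (expR_decay_add _ _ _ C10 C20) => //.
rewrite lerD//; first exact: tail.
(* Drift and [th * l] leave [- 4 k2 m]; the times before [b] and the quadratic terms use at most
   [2 k2 m]. One remaining [k2 m] absorbs the polynomial factor, the other is the decay. *)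
have exp_le : b%:R * (n_edges * (th * M) + th * I_info E mu g f S) +
      (b + m)%:R * (n_edges * (2 * th ^+ 2 * M ^+ 2)) -
      m%:R * (th * I_info E mu g f S) + th * l <= - (k2 * m%:R) - k2 * m%:R.
  rewrite -/IS /l.
  have h1 : (b + m)%:R * (n_edges * (2 * th ^+ 2 * M ^+ 2)) <= (b + m)%:R * k2 by rewrite ler_wpM2l.
  have h2 : b%:R * (n_edges * (th * M) + th * IS + k2) <= b%:R * (L%:R * k2) by rewrite ler_wpM2l.
  have h3 : b%:R * L%:R * k2 <= m%:R * k2 by rewrite ler_wpM2r// ltW.
  have h4 : th * (eps / 2 * m%:R) = 4 * (k2 * m%:R) by rewrite /k2; field.
  rewrite natrD in h1 *; lra.
apply: (@le_trans _ _ (((m + m).+1 ^ d)%:R * expR (- (k2 * m%:R) - k2 * m%:R))).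
  apply: ler_pM; rewrite ?expR_ge0//; last by rewrite ler_expR.
  by rewrite !natrX lerXn2r ?nnegrE// ler_nat ltnS leq_add2r.
rewrite expRD mulrA mulrAC ler_wpM2r ?expR_ge0//.
by rewrite -ler_pdivlMr ?expR_gt0// -expRN opprK.
Qed.

Lemma stopping_early_decay (eps : R) : 0 < eps -> exists C k : R, [/\ 0 <= C, 0 < k &
  forall (tau : Omega -> \bar R) (a : R) m, is_stopping_time (obs_filtration E X) tau -> 0 <= a ->
  (P [set w | (tau w < (phi w)%:R%:E)%E] <= a%:E)%E ->
  (P [set w | ((phi w)%:R%:E <= tau w <= (phi w + m)%:R%:E)%E] <=
    (C * expR (- (k * m%:R)) + expR ((qS + IS + eps) * m.+1%:R) * a)%:E)%E].
Proof.
move=> e0.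
have [th [L [th0 thM L0 [hN hL hq]]]] := chernoff_params e0.
have [C1 [k1 [C10 k10 tail]]] := geometric_tail_decay L0.
set k2 := th * eps / 4 in hN hL.
have k20 : 0 < k2 by rewrite divr_gt0// mulr_gt0.
exists (C1 + 1), (Num.min k1 k2); split.
- exact: addr_ge0.
- by rewrite lt_min k10.
move=> tau a m tau_stop a0 tau_a; pose b := (m %/ L)%N.
have bL : b%:R * L%:R <= m%:R :> R by rewrite -natrM ler_nat leq_trunc_div.
pose c := (IS + eps) * m.+1%:R.
apply: (le_trans (@stopping_early tau tau_stop a b m th c tau_a (ltW th0) thM)).
rewrite lee_fin lerD//; last first.
  by rewrite ler_wpM2r// ler_expR /c; lra.
apply: le_trans (expR_decay_add _ _ _ C10 ler01) => //.
rewrite lerD//; first exact: tail.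
rewrite mul1r ler_expR -/IS /c.
have h1 : m.+1%:R * (n_edges * (2 * th ^+ 2 * M ^+ 2)) <= m.+1%:R * k2 by rewrite ler_wpM2l.
have h2 : b%:R * (n_edges * (th * M) + th * IS + k2) <= b%:R * (L%:R * k2) by rewrite ler_wpM2l.
have h3 : b%:R * L%:R * k2 <= m%:R * k2 by rewrite ler_wpM2r// ltW.
have h4 : th * (eps * m.+1%:R) = 4 * (k2 * m.+1%:R) by rewrite /k2; field.
have h5 : 0 <= b%:R * (th * IS) by rewrite !mulr_ge0 ?I_info_ge0// ltW.
have h6 : 0 <= b%:R * k2 by rewrite mulr_ge0// ltW.
have h7 : 0 <= k2 * m%:R by rewrite mulr_ge0// ltW.
rewrite -natr1 in h1 h4 *; lra.
Qed.

(** * Asymptotics *)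

Let J := qS + IS.

Let J_gt0 : 0 < J.
Proof. by rewrite /J ltr_pwDl ?q_info_gt0// I_info_ge0. Qed.

Lemma expR_small (c x y : R) : 0 < y -> c / y <= x -> c * expR (- x) <= y.
Proof.
move=> y0; rewrite ler_pdivrMr// => cx.
rewrite expRN ler_pdivrMr ?expR_gt0// (le_trans cx)// mulrC ler_wpM2l ?(ltW y0)//.
by rewrite (le_trans _ (expR_ge1Dx _))// lerDr.
Qed.

Lemma ln_large (A a : R) : 0 < a < expR (- A) -> A < - ln a.
Proof. by move=> /andP[a0 aA]; rewrite ltrNr -[ltRHS]expRK ltr_ln ?posrE ?expR_gt0. Qed.

Lemma delay_lower_asymp (h : R) : 0 < h < 1 -> exists2 a0 : R, 0 < a0 < 1 &
  forall a tau, 0 < a < a0 -> is_stopping_time (obs_filtration E X) tau ->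
  (P [set w | (tau w < (phi w)%:R%:E)%E] <= a%:E)%E ->
  ((- ln a / J * (1 - h))%:E <= detection_delay P phi tau)%E.
Proof.
move=> /andP[h0 h1]; pose e := h * J / 4.
have J0 := J_gt0.
have e0 : 0 < e by rewrite divr_gt0// mulr_gt0.
have [cl [k [cl0 k0 early]]] := stopping_early_decay e0.
have h12 : 0 < h / 12 by rewrite divr_gt0.
(* Thresholds for [- ln a]: [x1], [x2] and [x3] make the false alarm level, the decay term and the
   change-of-measure term at most [h / 12] each, and [x4] makes rounding to [m] cost at most [h / 8]
   of the rate. The third uses [(1 + h / 4) (1 - h / 2) <= 1 - h / 4], whence [e = h J / 4]. *)
pose x1 := 1 / (h / 12).
pose x2 := 2 * J * (1 + cl / (h / 12) / k).
pose x3 := expR (J + e) / (h / 12) * (4 / h).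
pose x4 := 8 * J / h.
have x10 : 0 < x1 by rewrite divr_gt0.
have x20 : 0 <= x2.
  have : 0 <= cl / (h / 12) / k by rewrite !divr_ge0// ltW.
  by move=> ?; rewrite mulr_ge0// ?mulr_ge0 ?(ltW J0)// addr_ge0.
have x30 : 0 <= x3 by rewrite mulr_ge0 ?divr_ge0 ?expR_ge0// ltW.
have x40 : 0 <= x4 by rewrite divr_ge0 ?mulr_ge0// ltW.
exists (expR (- (x1 + x2 + x3 + x4))).
  by rewrite expR_gt0 expR_lt1 oppr_lt0; lra.
move=> a tau /[dup] /andP[a0 _] /ln_large; set A := - ln a => Ax tau_stop tau_a.
have aE : a = expR (- A) by rewrite /A opprK lnK.
have Ax1 : x1 <= A by lra.
have Ax2 : x2 <= A by lra.
have Ax3 : x3 <= A by lra.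
have Ax4 : x4 <= A by lra.
have A0 : 0 < A by lra.
pose B := A / J; have B0 : 0 < B by rewrite divr_gt0.
have AE : A = B * J by rewrite /B mulfVK// gt_eqF.
pose y := (1 - h / 2) * B; pose m := Num.truncn y.
have y0 : 0 <= y by rewrite mulr_ge0 ?(ltW B0)//; lra.
have my : m%:R <= y by rewrite truncn_le.
have ym : y < m%:R + 1 by rewrite natr1 truncnS_gt.
have a12 : a <= h / 12.
  by rewrite aE -[expR _]mul1r; exact: expR_small.
have hB : 0 <= h * B by rewrite mulr_ge0// ltW.
have r1 : cl * expR (- (k * m%:R)) <= h / 12.
  apply: expR_small => //; rewrite [k * _]mulrC -ler_pdivrMr//.
  have : x2 / (2 * J) <= A / (2 * J) by rewrite ler_pM2r// invr_gt0 mulr_gt0.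
  have -> : x2 / (2 * J) = 1 + cl / (h / 12) / k.
    by rewrite /x2 mulrAC divff ?mul1r// mulf_neq0 ?gt_eqF.
  have -> : A / (2 * J) = B / 2 by rewrite /B; field; rewrite gt_eqF.
  have hBB : h * B <= B by rewrite ler_piMl ?ltW.
  have yB : B / 2 <= y by rewrite /y; lra.
  move: (cl / (h / 12) / k) => q; clearbody m y; lra.
have r2 : expR ((qS + IS + e) * m.+1%:R) * a <= h / 12.
  rewrite -/J aE -expRD.
  apply: (@le_trans _ _ (expR (J + e) * expR (- (h * A / 4)))).
    rewrite -expRD ler_expR.
    have : (J + e) * m.+1%:R <= (J + e) * (y + 1).
      by rewrite -natr1 ler_wpM2l ?lerD2r// addr_ge0// ltW.
    have -> : (J + e) * (y + 1) = J + e + (1 + h / 4) * (1 - h / 2) * A.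
      by rewrite /y /e AE; field.
    have : 0 <= h * h * A by rewrite !mulr_ge0// ltW.
    by lra.
  apply: expR_small => //.
  have -> : h * A / 4 = A / (4 / h) by field; rewrite gt_eqF.
  by rewrite ler_pdivlMr ?divr_gt0.
have a1 : 0 < a < 1 by rewrite a0/=; lra.
have := early tau a m tau_stop (ltW a0) tau_a.
set r := _ + _ * a in r1 r2 * => rP.
have rb : r <= h / 6 by rewrite /r; lra.
apply: le_trans (delay_ge tau_stop a1 tau_a rP _); last by lra.
rewrite lee_fin -/A -/B.
apply: (@le_trans _ _ (m%:R * (1 - h / 4))); last by rewrite ler_wpM2l//; lra.
have B8 : 1 <= h / 8 * B.
  rewrite /x4 ler_pdivrMr// AE in Ax4.
  have : 8 <= B * h by rewrite -(ler_pM2r J0); lra.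
  by lra.
have : (y - 1) * (1 - h / 4) <= m%:R * (1 - h / 4) by rewrite ler_wpM2r; lra.
have : 0 <= h * h * B by rewrite mulr_ge0 ?(ltW B0)// mulr_ge0// ltW.
have : 0 <= (h / 8 * B - 1) * (1 - h / 4) by rewrite mulr_ge0; lra.
rewrite /y; lra.
Qed.

Lemma delay_upper_asymp (h : R) : 0 < h < 1 -> exists2 a0 : R, 0 < a0 < 1 &
  forall a, 0 < a < a0 ->
  (detection_delay P phi (tau_threshold post a) <= (- ln a / J * (1 + h))%:E)%E.
Proof.
move=> /andP[h0 h1]; pose e := h * J / 4.
have J0 := J_gt0.
have e0 : 0 < e by rewrite divr_gt0// mulr_gt0.
have [cl [k [c [cl0 k0 lateP]]]] := threshold_late_decay e0.
have De : 0 < J - e.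
  have : h * J <= J by rewrite ler_piMl ?ltW.
  by rewrite /e; lra.
pose K := cl / (1 - expR (- k)).
have K0 : 0 <= K by rewrite divr_ge0// subr_ge0 ltW// expR_lt1 oppr_lt0.
(* Collects what stays bounded as [a] tends to 0: the prior constant, the rounding of [m] and the
   geometric series. [x2] makes it at most [h / 4] of the rate, and [x1] controls the division by
   [1 - a]. *)
pose c2 := (1 + h / 2) * (`|c| / J) + 1 + K.
have h8 : 0 < h / 8 by rewrite divr_gt0.
pose x1 := 1 / (h / 8).
pose x2 := 4 * J * c2 / h.
have c20 : 0 <= c2.
  by rewrite /c2 addr_ge0// addr_ge0// mulr_ge0 ?divr_ge0 ?(ltW J0)//; lra.
have x10 : 0 < x1 by rewrite divr_gt0.
have x20 : 0 <= x2 by rewrite divr_ge0 ?(ltW h0)// mulr_ge0// mulr_ge0// ltW.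
exists (expR (- (x1 + x2))).
  by rewrite expR_gt0 expR_lt1 oppr_lt0; lra.
move=> a /[dup] /andP[a0 _] /ln_large; set A := - ln a => Ax.
have aE : a = expR (- A) by rewrite /A opprK lnK.
have Ax1 : x1 <= A by lra.
have Ax2 : x2 <= A by lra.
have A0 : 0 < A by lra.
pose B := A / J; have B0 : 0 < B by rewrite divr_gt0.
have a8 : a <= h / 8.
  by rewrite aE -[expR _]mul1r; exact: expR_small.
have a1 : 0 < a < 1 by rewrite a0/=; lra.
pose y := (A + `|c|) / (J - e); pose m := (Num.truncn y).+1.
have y0 : 0 <= y by rewrite divr_ge0 ?(ltW De)// addr_ge0// ltW.
have ym : y < m%:R by exact: truncnS_gt.
have my : m%:R <= y + 1 by rewrite /m -natr1 lerD2r truncn_le.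
have tau_stop := tau_threshold_stop a.
have tau_a := tau_threshold_false_alarm a1.
apply: (le_trans (@delay_le _ tau_stop a a1 tau_a m cl k cl0 k0 _)).
  move=> n mn; apply: lateP => //; rewrite -/A -/J.
  have : (J - e) * y < (J - e) * n%:R.
    by rewrite ltr_pM2l// (lt_le_trans ym)// ler_nat.
  rewrite /y mulrC mulfVK ?gt_eqF//.
  by have := ler_norm c; lra.
rewrite lee_fin -/A -/K -/B ler_pdivrMr; last by lra.
have yB : y <= (1 + h / 2) * (B + `|c| / J).
  rewrite /y ler_pdivrMr// /B -mulrDl.
  have -> : (1 + h / 2) * ((A + `|c|) / J) * (J - e) =
     (1 + h / 2) * (1 - h / 4) * (A + `|c|) by rewrite /e; field; rewrite gt_eqF.
  rewrite ler_peMl ?addr_ge0 ?(ltW A0)//.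
  have : 0 <= h * (1 - h) by rewrite mulr_ge0; lra.
  by lra.
have c2B : c2 <= h / 4 * B.
  move: Ax2; rewrite /x2 ler_pdivrMr// => Ax2.
  by rewrite /B mulrA ler_pdivlMr//; lra.
have : 0 <= B * (h * (1 - h)) by rewrite mulr_ge0 ?(ltW B0)// mulr_ge0; lra.
have : B * (1 + h) * a <= B * (1 + h) * (h / 8).
  by rewrite ler_wpM2l// mulr_ge0 ?(ltW B0)//; lra.
rewrite /c2 in c2B; lra.
Qed.

End Likelihood.

(** The two-sided bounds force [u a] to be finite for small [a], so its relative error is a real
    number and serves as the o(1) term. *)
Lemma asymp_eq0_squeeze {R : realType} (u : R -> \bar R) (r : R -> R) :
  (forall a, 0 < a < 1 -> 0 < r a) ->
  (forall h, 0 < h < 1 -> exists2 a0, 0 < a0 < 1 & forall a, 0 < a < a0 ->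
    ((r a * (1 - h))%:E <= u a <= (r a * (1 + h))%:E)%E) ->
  asymp_eq0 u (fun a => (r a)%:E).
Proof.
move=> r0 H; exists (fun a => fine (u a) / r a - 1).
  apply/cvgrPdist_le => e e0; pose h := Num.min e (1 / 2).
  have h01 : 0 < h < 1.
    by rewrite /h lt_min e0 gt_min /=; apply/andP; split; [|apply/orP; right]; lra.
  have [a0 /andP[a00 a01] Ha] := H h h01.
  near=> a.
  have a_gt0 : 0 < a by near: a; exact: nbhs_right_gt.
  have a_lt : a < a0 by near: a; exact: nbhs_right_lt.
  have : 0 < a < a0 by rewrite a_gt0.
  move=> /Ha; have : 0 < r a by apply: r0; rewrite a_gt0/= (lt_trans a_lt).
  case: (u a) => [x| |] ra; rewrite ?lee_fin; last 2 first.
  - by rewrite leye_eq andbF.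
  - by rewrite leeNy_eq.
  rewrite /= -(ler_pdivlMl _ _ ra) -(ler_pdivrMl _ _ ra) ![(r a)^-1 * _]mulrC => /andP[l1 l2].
  have he : h <= e by rewrite /h ge_min lexx.
  by rewrite sub0r normrN ler_norml; apply/andP; split; lra.
have [|a0 /andP[a00 a01] Ha] := H (1 / 2); first by lra.
near=> a.
have a_gt0 : 0 < a by near: a; exact: nbhs_right_gt.
have a_lt : a < a0 by near: a; exact: nbhs_right_lt.
have : 0 < a < a0 by rewrite a_gt0.
move=> /Ha; have : 0 < r a by apply: r0; rewrite a_gt0/= (lt_trans a_lt).
case: (u a) => [x| |] ra; last 2 first.
- by rewrite leye_eq andbF.
- by rewrite leeNy_eq.
by move=> _; rewrite -EFinM /= addrC subrK mulrCA divff ?mulr1// gt_eqF.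
Unshelve. all: by end_near. Qed.

Lemma asymp_eq0_quotient {R : realType} (u v : R -> \bar R) (r : R -> R) :
  asymp_eq0 u (fun a => (r a)%:E) -> asymp_eq0 v (fun a => (r a)%:E) ->
  asymp_eq0 u v.
Proof.
move=> [e1 e10 ue1] [e2 e20 ve2].
exists (fun a => (1 + e1 a) / (1 + e2 a) - 1).
  have c1 : 1 + e1 a @[a --> 0^'+] --> (1 : R).
    by rewrite -[X in _ --> X]addr0; apply: cvgD => //; exact: cvg_cst.
  have c2 : 1 + e2 a @[a --> 0^'+] --> (1 : R).
    by rewrite -[X in _ --> X]addr0; apply: cvgD => //; exact: cvg_cst.
  have c3 : (1 + e2 a)^-1 @[a --> 0^'+] --> (1^-1 : R) by apply: cvgV => //; exact: oner_neq0.
  rewrite [X in _ --> X](_ : 0 = 1 * 1^-1 - 1 :> R); last by rewrite invr1 mulr1 subrr.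
  by apply: cvgB; [exact: cvgM|exact: cvg_cst].
near=> a.
have -> : u a = ((r a)%:E * (1 + e1 a)%:E)%E by near: a.
have -> : v a = ((r a)%:E * (1 + e2 a)%:E)%E by near: a.
have : `|0 - e2 a| < 1 by near: a; exact: (cvgr_dist_lt _ _ e20 _ ltr01).
rewrite sub0r normrN ltr_norml => /andP[e2a _].
rewrite -!EFinM; congr (_%:E); rewrite addrCA subrr addr0 -mulrA; congr (_ * _).
by rewrite mulrCA divff ?mulr1// gt_eqF//; lra.
Unshelve. all: by end_near. Qed.

Theorem theorem1 (R : realType) (d : nat) (E : {set {set 'I_d}})
    (dT : measure_display) (T : measurableType dT)
    (mu : {measure set T -> \bar R}) (g f : {set 'I_d} -> T -> R)
    (dO : measure_display) (Omega : measurableType dO)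
    (P : probability Omega R)
    (lam : 'I_d -> {RV P >-> nat})
    (X : {set 'I_d} -> nat -> {RV P >-> T})
    (rho : 'I_d -> R) (M : R) (S : {set 'I_d})
    (post : nat -> Omega -> R) :
  is_graph E ->
  (forall e, e \in extended_edges E ->
     is_density mu (g e) /\ is_density mu (f e)) ->
  (forall j w, (1 <= lam j w)%N) ->
  observation_model E mu g f P lam X ->
  (forall e, e \in extended_edges E ->
     (sup_norm (llr (f e) (g e)) <= M%:E)%E) ->
  mutually_independent P setT lam ->
  (forall j, 0 < rho j < 1) ->
  geometric_prior P lam rho ->
  S != finset.set0 ->
  (forall n, (1 <= n)%N ->
     is_cond_pr P (obs_filtration E X n)
       [set w | (lam_min lam S w <= n)%N] (post n)) ->
  let F := obs_filtration E X in
  let phi := lam_min lam S in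
  let tau := tau_threshold post in
  let rate (a : R) : \bar R :=
    (`|ln a| / (q_info rho S + I_info E mu g f S))%:E in
  [/\ asymptotically_optimal P F phi tau,
      asymp_eq0 (fun a => detection_delay P phi (tau a)) rate
    & asymp_eq0 (optimal_delay P F phi) rate].

Proof.
move=> grE dens lam1 model supM lam_indep rho01 lam_geo S0 postP F phi tau rate.
(* [M] may be 0, when all [f e] and [g e] agree; the choice of [th] needs a positive bound. *)
pose M' := Num.max M 1.
have M1 : 1 <= M' by rewrite le_max lexx orbT.
have supM' e : e \in extended_edges E -> (sup_norm (llr (f e) (g e)) <= M'%:E)%E.
  by move=> /supM/le_trans; apply; rewrite lee_fin le_max lexx.
pose J := q_info rho S + I_info E mu g f S.
have J0 : 0 < J.
  by rewrite ltr_pwDl ?(q_info_gt0 rho01 S0)// (I_info_ge0 dens supM').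
have tau_rule a : 0 < a < 1 -> detection_rules P F phi a (tau a).
  move=> a01; split; first exact: (tau_threshold_stop postP).
  exact: (tau_threshold_false_alarm postP a01).
have absln a : 0 < a < 1 -> `|ln a| = - ln a.
  by move=> /andP[a0 a1]; rewrite ler0_norm// ln_le0// ltW.
have rate0 a : 0 < a < 1 -> 0 < `|ln a| / J.
  move=> a01; rewrite divr_gt0// absln// oppr_gt0.
  by have /andP[a0 a1] := a01; rewrite ln_lt0// a0.
have opt_lower h : 0 < h < 1 -> exists2 a0, 0 < a0 < 1 & forall a, 0 < a < a0 ->
    ((`|ln a| / J * (1 - h))%:E <= optimal_delay P F phi a)%E.
  move=> h01.
  have [a0 a001 low] := delay_lower_asymp dens lam1 model supM' lam_indep rho01 lam_geo grE S0 M1 h01.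
  exists a0 => // a aa0; have a01 : 0 < a < 1.
    by have /andP[-> /lt_trans->//] := aa0; have /andP[] := a001.
  rewrite absln//; apply: le_ereal_inf_tmp => _ [t [t_stop t_a] <-].
  exact: low.
have tau_upper h : 0 < h < 1 -> exists2 a0, 0 < a0 < 1 & forall a, 0 < a < a0 ->
    (detection_delay P phi (tau a) <= (`|ln a| / J * (1 + h))%:E)%E.
  move=> h01.
  have [a0 a001 upp] := delay_upper_asymp dens lam1 model supM' lam_indep rho01 lam_geo grE S0 M1 postP h01.
  exists a0 => // a aa0; have a01 : 0 < a < 1.
    by have /andP[-> /lt_trans->//] := aa0; have /andP[] := a001.
  by rewrite absln//; exact: upp.
(* Since [tau a] is admissible, the lower bound for all rules and the upper bound for [tau] sandwich
   both delays. *)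
have opt_le a : 0 < a < 1 -> (optimal_delay P F phi a <= detection_delay P phi (tau a))%E.
  by move=> a01; apply: ereal_inf_lbound; exists (tau a) => //; exact: tau_rule.
have both h : 0 < h < 1 -> exists2 a0, 0 < a0 < 1 & forall a, 0 < a < a0 ->
    [/\ 0 < a < 1, ((`|ln a| / J * (1 - h))%:E <= optimal_delay P F phi a)%E &
        (detection_delay P phi (tau a) <= (`|ln a| / J * (1 + h))%:E)%E].
  move=> h01; have [b /andP[b0 b1] low] := opt_lower h h01.
  have [c /andP[c0 c1] upp] := tau_upper h h01.
  exists (Num.min b c); first by rewrite lt_min b0 c0 gt_min b1.
  move=> a /andP[a0]; rewrite lt_min => /andP[ab ac].
  by split; rewrite ?a0/= ?(lt_trans ab)//; [apply: low|apply: upp]; rewrite a0.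
have tau_rate : asymp_eq0 (fun a => detection_delay P phi (tau a)) rate.
  apply: asymp_eq0_squeeze => // h /both[a0 a001 H]; exists a0 => // a /H[a01 low upp].
  by rewrite upp andbT (le_trans low)// opt_le.
have opt_rate : asymp_eq0 (optimal_delay P F phi) rate.
  apply: asymp_eq0_squeeze => // h /both[a0 a001 H]; exists a0 => // a /H[a01 low upp].
  by rewrite low/= (le_trans _ upp)// opt_le.
split => //; split => //.
exact: asymp_eq0_quotient tau_rate opt_rate.
Qed.
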